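(* Let $n\ge 2$ and $\lfloor\frac{n+1}{2}\rfloor\le l\le\binom n2$. The map sending (the isomorphism class of) a fundamental basic block $F$ with exactly $n$ reducible elements $u_1<u_2<\cdots<u_n$ and nullity $l$ to the directed graph $\overrightarrow{G_F}$ on vertices $v_1,\dots,v_n$ having an arc $(v_i,v_j)$ (with $i<j$) exactly when $(u_i,u_j)$ is an adjunct pair in the adjunct representation of $F$ is a bijection from $\mathscr F_n(l)$ onto $\overrightarrow{\mathscr D}(n,l)$.
   Context: An element of a lattice is reducible if it is $y\vee z$ or $y\wedge z$ for some $y,z$ both distinct from it; an element of a poset is doubly irreducible if it has at most one upper and at most one lower cover. The nullity $\eta(P)$ of a finite poset is $|E|-|V|+c$ for its cover graph (edges = coverings), $c$ the number of components. Adjunct operation: for disjoint lattices $L_1,L_2$ and $a<b$ in $L_1$ with $b$ not covering $a$, $L_1\,]_a^b\,L_2$ is $L_1\cup L_2$ with $x\le y$ iff $x\le y$ within $L_1$ or within $L_2$, or $x\in L_1,y\in L_2,x\le a$, or $x\in L_2,y\in L_1,b\le y$. An RC-lattice is a finite lattice whose reducible elements are pairwise comparable; it is an adjunct of chains $C_0\,]_{a_1}^{b_1}C_1\cdots]_{a_r}^{b_r}C_r$ ($C_0$ maximal chain), unique up to order of adjunct pairs. A basic block is a poset that has one element, or has no doubly irreducible elements, or from which removal of a doubly irreducible element reduces nullity by one. A fundamental basic block is an RC-lattice that is a basic block whose adjunct representation has pairwise distinct adjunct pairs. $\mathscr F_n(l)$ is the set of isomorphism classes of fundamental basic blocks with exactly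 $n$ reducible elements and nullity $l$. $\overrightarrow{\mathscr D}(n,l)$ is the set of directed graphs on the labeled vertex set $\{v_1,\dots,v_n\}$ with exactly $l$ arcs, every arc of the form $(v_i,v_j)$ with $i<j$, and no isolated vertex (labeled graphs are identified only if they have the same arc set). *)

(* Defs.v *)
From mathcomp Require Import all_boot.
Set Implicit Arguments. Unset Strict Implicit. Unset Printing Implicit Defensive.

Section PosetDefs.
Variables (T : finType) (le : rel T).

Definition is_poset : Prop :=
  reflexive le /\ antisymmetric le /\ transitive le.

Definition is_lub_in (S : {pred T}) (x y j : T) : bool :=
  [&& j \in S, le x j, le y j &
      [forall z, (z \in S) ==> le x z ==> le y z ==> le j z]].
Definition is_glb_in (S : {pred T}) (x y m : T) : bool :=
  [&& m \in S, le m x, le m y &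
      [forall z, (z \in S) ==> le z x ==> le z y ==> le z m]].

Definition is_lub x y j := is_lub_in predT x y j.
Definition is_glb x y m := is_glb_in predT x y m.

Definition is_lattice_on (S : {pred T}) : Prop :=
  forall x y, x \in S -> y \in S ->
    (exists j, is_lub_in S x y j) /\ (exists m, is_glb_in S x y m).

Definition is_finite_lattice : Prop :=
  is_poset /\ 0 < #|T| /\ is_lattice_on predT.

Definition reducible (x : T) : bool :=
  [exists y, exists z, [&& y != x, z != x & is_lub y z x || is_glb y z x]].

Definition is_RC_lattice : Prop :=
  is_finite_lattice /\
  forall x y, reducible x -> reducible y -> le x y || le y x.

Definition covers_in (A : {set T}) (x y : T) : bool :=
  [&& x \in A, y \in A, le x y, x != y &
      [forall z, (z \in A) ==>
         ~~ [&& le x z, le z y, z != x & z != y]]].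

Definition covers := covers_in setT.

Definition doubly_irr (x : T) : bool :=
  (#|[set y | covers x y]| <= 1) && (#|[set y | covers y x]| <= 1).

Definition cover_graph (A : {set T}) : rel T :=
  fun x y => covers_in A x y || covers_in A y x.

(* nullity |E| - |V| + c of the cover graph of the subposet A
   (the quantity |E| + c - |V| is always >= 0, so nat subtraction is exact) *)
Definition nullity (A : {set T}) : nat :=
  #|[set p : T * T | covers_in A p.1 p.2]|
  + n_comp (cover_graph A) [pred x | x \in A] - #|A|.

Definition basic_block : Prop :=
  #|T| = 1 \/ (forall x, ~~ doubly_irr x) \/
  (forall x, doubly_irr x -> nullity setT = (nullity (setT :\ x)).+1).

(* Adjunct representation C_0 ]_{a_1}^{b_1} C_1 ... ]_{a_r}^{b_r} C_r of
   the lattice (T,le), realised inside T: c x is the index of the chain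
   containing x, L_i = {x | c x <= i}, (a i, b i) is the i-th adjunct pair
   (1 <= i <= r). *)
Definition adj_rep (r : nat) (c : T -> nat) (a b : nat -> T) : Prop :=
  (forall x, c x <= r) /\
  (exists x, c x = 0) /\
  (forall x y, c x = 0 -> c y = 0 -> le x y || le y x) /\
  (forall y, (forall x, c x = 0 -> le x y || le y x) -> c y = 0) /\
  (* L_i = L_{i-1} ]_{a_i}^{b_i} C_i *)
  (forall i, 1 <= i <= r ->
     (exists x, c x = i) /\
     (forall x y, c x = i -> c y = i -> le x y || le y x) /\
     is_lattice_on [pred x | c x < i] /\
     c (a i) < i /\ c (b i) < i /\ le (a i) (b i) /\ a i <> b i /\
     (exists z, c z < i /\ z <> a i /\ z <> b i /\ le (a i) z /\ le z (b i)) /\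
     (forall x y, c x < i -> c y = i -> le x y = le x (a i)) /\
     (forall x y, c x = i -> c y < i -> le x y = le (b i) y)).

Definition adjunct_pair (x y : T) : Prop :=
  exists r c a b, adj_rep r c a b /\
    exists i, 1 <= i <= r /\ a i = x /\ b i = y.

Definition fundamental_basic_block : Prop :=
  is_RC_lattice /\ basic_block /\
  exists r c a b, adj_rep r c a b /\
    (forall i j, 1 <= i <= r -> 1 <= j <= r -> a i = a j -> b i = b j -> i = j).

Definition num_reducible : nat := #|[set x | reducible x]|.

(* position of x in the chain of reducible elements u_1 < ... < u_n
   (0-based: u_{k+1} has rank k) *)
Definition red_rank (x : T) : nat :=
  #|[set y | [&& reducible y, le y x & y != x]]|.

Definition GF_arc (n : nat) (i j : 'I_n) : Prop :=
  exists x y, [&& reducible x, reducible y, red_rank x == i & red_rank y == j]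
              /\ adjunct_pair x y.

End PosetDefs.

Definition poset_iso (T1 T2 : finType) (le1 : rel T1) (le2 : rel T2) : Prop :=
  exists f : T1 -> T2, bijective f /\ forall x y, le1 x y = le2 (f x) (f y).

Definition Dgraph (n l : nat) (D : {set 'I_n * 'I_n}) : bool :=
  [&& [forall p in D, p.1 < p.2], #|D| == l &
      [forall v : 'I_n, [exists p in D, (p.1 == v) || (p.2 == v)]]].

Definition in_Fnl (n l : nat) (T : finType) (le : rel T) : Prop :=
  fundamental_basic_block le /\ num_reducible le = n /\ nullity le setT = l.

(* Main.v *)
Require Import Defs.
From mathcomp Require Import all_boot.
From mathcomp Require Import zify.

Set Implicit Arguments. Unset Strict Implicit. Unset Printing Implicit Defensive.

(* Deleting an element x with unique covers p < x < q costs two covers and one element, and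
   creates the cover (p, q) unless some other y lies strictly between p and q. So a lattice
   with at least two elements is a basic block iff every doubly irreducible x is bypassed by
   such a y; in an RC-lattice the feet p and q of an irreducible x are then reducible, and
   distinct x, y satisfy x <= y iff the upper foot of x is below the lower foot of y. The
   order is thus determined by the ranks of the feet in the chain of reducible elements (a
   reducible element being its own feet).
   In an adjunct representation the adjunct pairs are exactly the feet of the irreducible
   elements. If the pairs are distinct, each is the feet of exactly one irreducible element,
   or of exactly two when no reducible element lies in between. So the digraph determines
   how many elements have given feet, hence the block up to isomorphism; conversely these
   multiplicities define a block for every digraph without isolated vertices. The nullity is
   the number of arcs because a reducible element of positive rank has one lower cover more
   than it has incoming arcs, while every irreducible element has exactly one. *)

(** * Covers and nullity *)

Definition converse (T : Type) (le : rel T) : rel T := fun x y => le y x.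

Definition between (T : eqType) (le : rel T) (u v : T) : pred T :=
  fun w => [&& le u w, le w v, w != u & w != v].

Lemma between_converse (T : eqType) (le : rel T) u v w :
  between (converse le) u v w = between le v u w.
Proof. by rewrite /between andbCA; do 2!congr andb; rewrite andbC. Qed.

Section Covers.
Variables (T : finType) (le : rel T).

Lemma covers_inP (A : {set T}) x y :
  reflect [/\ x \in A, y \in A, le x y, x != y &
              forall z, z \in A -> ~~ between le x y z]
          (covers_in le A x y).
Proof.
apply: (iffP and5P) => -[xA yA xy neq_xy no_between]; split=> //.
  by move=> z zA; move/forallP/(_ z): no_between; rewrite zA.
by apply/forallP => z; apply/implyP/no_between.
Qed.

Lemma coversP x y :
  reflect [/\ le x y, x != y & forall z, ~~ between le x y z] (covers le x y).
Proof.
apply: (iffP (covers_inP _ _ _)) => [[_ _ xy neq_xy no_between]|[xy neq_xy no_between]].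
  by split=> // z; apply: no_between; rewrite inE.
by split; rewrite ?inE.
Qed.

Lemma covers_between x y z :
  covers le x y -> le x z -> le z y -> z = x \/ z = y.
Proof.
case/coversP=> _ _ /(_ z) + xz zy.
by rewrite /between xz zy /= negb_and !negbK => /orP[] /eqP; [left|right].
Qed.

Lemma covers_in_converse (A : {set T}) x y :
  covers_in (converse le) A x y = covers_in le A y x.
Proof.
rewrite /covers_in eq_sym andbCA; do 4!congr (_ && _).
by apply: eq_forallb => z; congr (_ ==> ~~ _); apply: between_converse.
Qed.

Lemma covers_converse x y : covers (converse le) x y = covers le y x.
Proof. exact: covers_in_converse. Qed.

Lemma card_lower_covers_converse x :
  #|[set y | covers (converse le) y x]| = #|[set y | covers le x y]|.
Proof. by apply: eq_card => y; rewrite !inE covers_converse. Qed.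

Lemma doubly_irr_converse x : doubly_irr (converse le) x = doubly_irr le x.
Proof.
rewrite /doubly_irr andbC card_lower_covers_converse; congr (_ && (_ <= 1)).
by apply: eq_card => y; rewrite !inE covers_converse.
Qed.

Definition bypassed (x : T) : Prop :=
  exists p q y, [/\ covers le p x, covers le x q, between le p q y & y != x].

Definition cover_pairs (A : {set T}) : {set T * T} :=
  [set p | covers_in le A p.1 p.2].

Lemma cover_graph_sym (A : {set T}) : symmetric (cover_graph le A).
Proof. by move=> x y; rewrite /cover_graph orbC. Qed.

Lemma cover_graph_closed (A : {set T}) :
  closed (cover_graph le A) [pred x | x \in A].
Proof. by move=> x y; rewrite !inE => /orP[] /covers_inP[-> -> _ _ _]. Qed.

Lemma n_comp_cover_graph_gt0 (A : {set T}) x :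
  x \in A -> 0 < n_comp (cover_graph le A) [pred x | x \in A].
Proof.
move=> xA; have sym := sym_connect_sym (@cover_graph_sym A).
apply/card_gt0P; exists (root (cover_graph le A) x).
have := closed_connect (@cover_graph_closed A) (connect_root (cover_graph le A) x).
by rewrite !inE roots_root //= => <-.
Qed.

Lemma covers_delete x a b :
  covers le a b -> a != x -> b != x -> covers_in le (setT :\ x) a b.
Proof.
case/coversP=> ab neq_ab no_between ax bx.
by apply/covers_inP; split; rewrite ?inE ?ax ?bx.
Qed.

End Covers.

Lemma bypassed_converse (T : finType) (le : rel T) x :
  bypassed le x -> bypassed (converse le) x.
Proof.
case=> p [q [y [px xq pqy yx]]]; exists q, p, y.
by rewrite !(covers_converse le) between_converse.
Qed.

Lemma card_rel_delete (T : finType) (e : rel T) x : ~~ e x x ->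
  #|[set p | e p.1 p.2]| =
  #|[set p | [&& e p.1 p.2, p.1 != x & p.2 != x]]|
  + #|[set y | e x y]| + #|[set y | e y x]|.
Proof.
move=> irrefl; pose E := [set p | e p.1 p.2].
pose from := [set p : T * T | p.1 == x]; pose to := [set p : T * T | p.2 == x].
have -> : #|[set y | e x y]| = #|E :&: from|.
  rewrite -(card_imset _ (_ : injective (pair x))); last by move=> ? ? [].
  apply: eq_card => -[a b]; rewrite !inE; apply/imsetP/andP => /= [[y] | [ab /eqP<-]].
    by rewrite inE => xy [-> ->].
  by exists b; rewrite ?inE.
have -> : #|[set y | e y x]| = #|(E :\: from) :&: to|.
  rewrite -(card_imset _ (_ : injective (fun y => (y, x)))); last by move=> ? ? [].
  apply: eq_card => -[a b]; rewrite !inE -andbA; apply/imsetP/and3P => /= [[y]|].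
    by rewrite inE => yx [-> ->]; split=> //; apply: contraNneq irrefl => {1}<-.
  by case=> _ ab /eqP<-; exists a; rewrite ?inE.
rewrite -/E -(cardsID from E) -(cardsID to (E :\: from)) [LHS]addnA [LHS]addnC [LHS]addnA.
congr (_ + _ + _); apply: eq_card => p; rewrite !inE.
by rewrite andbC andbAC andbC.
Qed.

Section Poset.
Variables (T : finType) (le : rel T).
Hypothesis le_poset : is_poset le.

Lemma poset_refl : reflexive le.
Proof. by case: le_poset. Qed.

Lemma poset_anti x y : le x y -> le y x -> x = y.
Proof. by case: le_poset => _ [anti _] xy yx; apply: anti; rewrite xy. Qed.

Lemma poset_trans : transitive le.
Proof. by case: le_poset => _ []. Qed.

Lemma poset_converse : is_poset (converse le).
Proof.
split=> [x|]; first exact: poset_refl.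
split=> [x y /andP[yx xy]|y x z yx zy]; first exact: poset_anti.
exact: poset_trans zy yx.
Qed.

Lemma proper_lower_set x y :
  le x y -> x != y -> [set w | le w x] \proper [set w | le w y].
Proof.
move=> xy neq_xy; apply/properP; split.
  by apply/subsetP => w; rewrite !inE => wx; apply: poset_trans wx xy.
exists y; rewrite !inE ?poset_refl //.
by apply: contra neq_xy => yx; apply/eqP/poset_anti.
Qed.

Lemma between_below u v w x :
  between le u v w -> le u x -> le x w -> ~~ between le u v x -> x = u.
Proof.
case/and4P=> _ wv _ neq_wv ux xw; rewrite /between ux (poset_trans xw wv) /=.
rewrite negb_and !negbK => /orP[/eqP//|/eqP ev]; case/eqP: neq_wv.
by apply: poset_anti; rewrite // -ev.
Qed.

Lemma ex_lower_cover_in (A : {set T}) x y :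
  x \in A -> y \in A -> le x y -> x != y ->
  exists2 z, covers_in le A z y & le x z.
Proof.
move=> xA yA xy neq_xy.
pose below z := [&& z \in A, le x z, le z y & z != y].
have below_x : below x by rewrite /below xA poset_refl xy.
case: (arg_maxnP (fun z => #|[set w | le w z]|) below_x) => z.
case/and4P=> zA xz zy neq_zy z_max.
exists z => //; apply/covers_inP; split=> // w wA.
apply/negP => /and4P[zw wy neq_wz neq_wy].
have /z_max : below w by rewrite /below wA (poset_trans xz zw) wy.
by rewrite /= leqNgt proper_card // proper_lower_set // eq_sym.
Qed.

Lemma ex_lower_cover x y :
  le x y -> x != y -> exists2 z, covers le z y & le x z.
Proof. by apply: ex_lower_cover_in; rewrite inE. Qed.

Lemma le_lower_cover x p a :
  doubly_irr le x -> covers le p x -> le a x -> a != x -> le a p.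
Proof.
move=> /andP[_ /card_le1_eqP one_lower] px ax neq_ax.
have [z zx az] := ex_lower_cover ax neq_ax.
by have -> : p = z by apply: one_lower; rewrite inE.
Qed.

Lemma n_comp_cover_graph_bottom (A : {set T}) m :
  m \in A -> (forall x, x \in A -> le m x) ->
  n_comp (cover_graph le A) [pred x | x \in A] = 1.
Proof.
move=> mA m_le; have sym := sym_connect_sym (@cover_graph_sym _ le A).
rewrite -(n_comp_connect sym m); apply: eq_n_comp_r => x; apply/idP/idP; last first.
  by move=> mx; rewrite -(closed_connect (@cover_graph_closed _ le A) mx).
rewrite !inE => xA.
have [k] := ubnP #|[set w | le w x]|; elim: k x xA => // k IH x xA card_x.
have [->|neq_mx] := eqVneq m x; first exact: connect0.
have [y cover_yx _] := ex_lower_cover_in mA xA (m_le _ xA) neq_mx.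
have /covers_inP[yA _ yx neq_yx _] := cover_yx.
apply: (connect_trans (y := y)); last by rewrite connect1 // /cover_graph cover_yx.
apply: IH => //; rewrite ltnS in card_x; apply: leq_trans card_x.
exact/proper_card/proper_lower_set.
Qed.

Lemma card_cover_pairs_ge (A : {set T}) m :
  m \in A -> (forall x, x \in A -> le m x) -> #|A| <= #|cover_pairs le A|.+1.
Proof.
move=> mA m_le; rewrite (cardsD1 m) mA ltnS.
pose lower_cover y := odflt y [pick z | covers_in le A z y].
rewrite -(card_imset _ (_ : injective (fun y => (lower_cover y, y)))); last by move=> ? ? [].
apply/subset_leq_card/subsetP => _ /imsetP[y + ->]; rewrite !inE => /andP[neq_ym yA].
have [|z zy _] := ex_lower_cover_in mA yA (m_le _ yA); first by rewrite eq_sym.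
by rewrite /= /lower_cover; case: pickP => //= /(_ z); rewrite zy.
Qed.

Lemma nullity_bottom (A : {set T}) m :
  m \in A -> (forall x, x \in A -> le m x) ->
  nullity le A + #|A| = #|cover_pairs le A|.+1.
Proof.
move=> mA m_le; rewrite /nullity (n_comp_cover_graph_bottom mA m_le) addn1 subnK //.
exact: card_cover_pairs_ge mA m_le.
Qed.

End Poset.

Lemma between_above (T : finType) (le : rel T) u v w x :
  is_poset le -> between le u v w -> le w x -> le x v -> ~~ between le u v x -> x = v.
Proof.
move=> /poset_converse ge_poset; rewrite -!(between_converse le) => uvw wx xv.
exact: (between_below ge_poset uvw xv wx).
Qed.

Lemma le_upper_cover (T : finType) (le : rel T) x q a :
  is_poset le -> doubly_irr le x -> covers le x q -> le x a -> a != x -> le q a.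
Proof.
move=> /poset_converse ge_poset; rewrite -doubly_irr_converse -covers_converse => irr xq xa.
exact: (le_lower_cover ge_poset irr xq xa).
Qed.

Section Bypass.
Variables (T : finType) (le : rel T) (m : T).
Hypothesis le_poset : is_poset le.
Hypothesis m_bottom : forall x, le m x.

Let nullity_setT : nullity le setT + #|T| = #|cover_pairs le setT|.+1.
Proof. by rewrite -cardsT; apply: (nullity_bottom le_poset (m := m)); rewrite ?inE. Qed.

Let card_deleted (x : T) : #|T| = #|setT :\ x|.+1.
Proof. by rewrite -cardsT (cardsD1 x) inE. Qed.

Let card_cover_pairs_split x :
  #|cover_pairs le setT| =
  #|[set p | [&& covers le p.1 p.2, p.1 != x & p.2 != x]]|
  + #|[set y | covers le x y]| + #|[set y | covers le y x]|.
Proof. by apply: card_rel_delete; apply/negP => /coversP[_ /eqP]. Qed.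

Lemma nullity_drop_bypassed x :
  1 < #|T| -> doubly_irr le x ->
  nullity le setT = (nullity le (setT :\ x)).+1 -> bypassed le x.
Proof.
move=> T_gt1 /andP[upper_le1 lower_le1] drop.
have [y yx] : exists y, y \in setT :\ x by apply/card_gt0P; rewrite (card_deleted x) in T_gt1.
pose kept := [set p : T * T | [&& covers le p.1 p.2, p.1 != x & p.2 != x]].
have sub_kept : kept \subset cover_pairs le (setT :\ x).
  by apply/subsetP => p; rewrite !inE => /and3P[]; apply: covers_delete.
have [upper_gt0 lower_gt0 card_kept] : [/\ 0 < #|[set y | covers le x y]|,
    0 < #|[set y | covers le y x]| & #|cover_pairs le (setT :\ x)| <= #|kept|].
  have drop_arith u d e e' k v : u <= 1 -> d <= 1 -> 0 < k -> e <= e' ->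
      (e' + k - v).+1 + v.+1 = (e + u + d).+1 -> [/\ 0 < u, 0 < d & e' <= e].
    by move=> *; split; lia.
  apply: drop_arith upper_le1 lower_le1 (n_comp_cover_graph_gt0 le yx) _ _.
    exact: subset_leq_card sub_kept.
  by rewrite -card_cover_pairs_split -nullity_setT drop (card_deleted x).
have /eqP keptE : kept == cover_pairs le (setT :\ x) by rewrite eqEcard sub_kept.
case/card_gt0P: upper_gt0 => q; rewrite inE => xq.
case/card_gt0P: lower_gt0 => p; rewrite inE => px.
have [le_px neq_px _] := coversP _ _ _ px; have [le_xq neq_xq _] := coversP _ _ _ xq.
have neq_pq : p != q.
  by apply: contraNneq neq_px => pq; apply/eqP/(poset_anti le_poset); rewrite // pq.
have : ~~ covers_in le (setT :\ x) p q.
  apply/negP => pq; have : (p, q) \in kept by rewrite keptE inE.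
  rewrite inE => /and3P[/coversP[_ _ /(_ x)]].
  by rewrite /between le_px le_xq eq_sym neq_px neq_xq.
rewrite /covers_in !inE neq_px eq_sym neq_xq neq_pq (poset_trans le_poset le_px le_xq).
case/forallPn => z; rewrite !inE andbT negb_imply negbK => /andP[neq_zx pqz].
by exists p, q, z.
Qed.

Lemma covers_in_bypass x a b :
  doubly_irr le x -> bypassed le x ->
  covers_in le (setT :\ x) a b = [&& covers le a b, a != x & b != x].
Proof.
move=> irr [p [q [y [px xq /and4P[py yq neq_yp neq_yq] neq_yx]]]].
apply/idP/and3P => [|[ab ax bx]]; last exact: covers_delete.
case/covers_inP; rewrite !inE !andbT => ax bx ab neq_ab no_between.
split=> //; apply/coversP; split=> // z; have [->|neq_zx] := eqVneq z x; last first.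
  by apply: no_between; rewrite !inE neq_zx.
apply/negP => /and4P[le_ax le_xb _ _].
have le_ap := le_lower_cover le_poset irr px le_ax ax.
have le_qb := le_upper_cover le_poset irr xq le_xb bx.
have := no_between y; rewrite !inE neq_yx => /(_ isT)/negP; apply; apply/and4P; split.
- exact: poset_trans le_ap py.
- exact: poset_trans yq le_qb.
- by apply: contraNneq neq_yp => ya; apply/eqP/(poset_anti le_poset); rewrite // ya.
- by apply: contraNneq neq_yq => yb; apply/eqP/(poset_anti le_poset); rewrite // yb.
Qed.

Lemma nullity_delete_bypassed x :
  doubly_irr le x -> bypassed le x ->
  nullity le setT = (nullity le (setT :\ x)).+1.
Proof.
move=> irr bypass; have [p [q [_ [px xq _ _]]]] := bypass.
have neq_mx : m != x.
  have [le_px neq_px _] := coversP _ _ _ px.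
  by apply: contraNneq neq_px => mx; apply/eqP/(poset_anti le_poset); rewrite // -mx.
have nullity_deleted : nullity le (setT :\ x) + #|setT :\ x|
    = #|cover_pairs le (setT :\ x)|.+1.
  by apply: (nullity_bottom le_poset (m := m)); rewrite ?inE ?neq_mx.
have keptE : cover_pairs le (setT :\ x)
    = [set p | [&& covers le p.1 p.2, p.1 != x & p.2 != x]].
  by apply/setP => -[a b]; rewrite !inE covers_in_bypass.
have upper_gt0 : 0 < #|[set y | covers le x y]| by apply/card_gt0P; exists q; rewrite inE.
have lower_gt0 : 0 < #|[set y | covers le y x]| by apply/card_gt0P; exists p; rewrite inE.
have /andP[upper_le1 lower_le1] := irr.
have upper1 : #|[set y | covers le x y]| = 1 by apply/eqP; rewrite eqn_leq upper_le1.
have lower1 : #|[set y | covers le y x]| = 1 by apply/eqP; rewrite eqn_leq lower_le1.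
apply/eqP; rewrite -(eqn_add2r #|T|) nullity_setT (card_cover_pairs_split x) upper1 lower1.
by rewrite (card_deleted x) addSnnS -keptE !addn1 addnS addnS nullity_deleted.
Qed.

Lemma basic_blockP :
  1 < #|T| -> basic_block le <-> (forall x, doubly_irr le x -> bypassed le x).
Proof.
move=> T_gt1; split=> [[card_T|[none|drop]] x irr|bypass].
- by rewrite card_T in T_gt1.
- by rewrite (negPf (none x)) in irr.
- exact: nullity_drop_bypassed (drop x irr).
by right; right=> x irr; apply: nullity_delete_bypassed (bypass x irr).
Qed.

End Bypass.

(** * RC-lattices *)

Section Lattice.
Variables (T : finType) (le : rel T).

Lemma is_lub_inP (S : {pred T}) x y j :
  reflect [/\ j \in S, le x j, le y j &
              forall z, z \in S -> le x z -> le y z -> le j z]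
          (is_lub_in le S x y j).
Proof.
apply: (iffP and4P) => [[jS xj yj /forallP lub]|[jS xj yj lub]]; split=> //.
  by move=> z zS xz yz; move: (lub z); rewrite zS xz yz.
apply/forallP => z; apply/implyP => zS; apply/implyP => xz; apply/implyP; exact: lub.
Qed.

Lemma is_lubP x y j :
  reflect [/\ le x j, le y j & forall z, le x z -> le y z -> le j z]
          (is_lub le x y j).
Proof.
apply: (iffP (is_lub_inP _ _ _ _)) => [[_ xj yj lub]|[xj yj lub]]; split=> // z.
  exact: lub.
by move=> _; apply: lub.
Qed.

Lemma comparable_lub_in (S : {pred T}) x y :
  is_poset le -> x \in S -> y \in S -> le x y || le y x -> exists j, is_lub_in le S x y j.
Proof.
move=> le_poset xS yS /orP[xy|yx]; [exists y|exists x]; apply/is_lub_inP; split=> //;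
  exact: poset_refl.
Qed.

Lemma reducibleP x :
  reflect (exists y z, [/\ y != x, z != x & is_lub le y z x || is_glb le y z x])
          (reducible le x).
Proof.
apply: (iffP existsP) => [[y /existsP[z /and3P[yx zx bound]]]|[y [z [yx zx bound]]]].
  by exists y, z.
by exists y; apply/existsP; exists z; apply/and3P.
Qed.

Lemma reducible_converse x : reducible (converse le) x = reducible le x.
Proof. by apply: eq_existsb => y; apply: eq_existsb => z; rewrite orbC. Qed.

Lemma lattice_on_converse (S : {pred T}) :
  is_lattice_on le S -> is_lattice_on (converse le) S.
Proof. by move=> lattice x y xS yS; have [] := lattice x y xS yS. Qed.

Lemma finite_lattice_converse :
  is_finite_lattice le -> is_finite_lattice (converse le).
Proof.
case=> le_poset [T_gt0 lattice]; split; first exact: poset_converse.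
by split; last exact: lattice_on_converse.
Qed.

Lemma bottom_exists : is_finite_lattice le -> exists m, forall x, le m x.
Proof.
case=> le_poset [/card_gt0P[x0 _] lattice].
have [m _ m_min] := @arg_minnP _ x0 predT (fun m => #|[set w | le w m]|) isT.
exists m => x; have [_ [g /and4P[_ gm gx _]]] := lattice m x isT isT.
have [<- //|neq_gm] := eqVneq g m.
by have := m_min g isT; rewrite leqNgt proper_card // proper_lower_set.
Qed.

Lemma lub_lower_covers x y z :
  is_poset le -> is_lub le y z x -> y != x -> z != x ->
  1 < #|[set w | covers le w x]|.
Proof.
move=> le_poset /is_lubP[yx zx lub] neq_yx neq_zx.
rewrite ltnNge; apply/negP => /card_le1_eqP one_lower.
have [y' y'x yy'] := ex_lower_cover le_poset yx neq_yx.
have [z' z'x zz'] := ex_lower_cover le_poset zx neq_zx.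
have eq_yz : y' = z' by apply: one_lower; rewrite inE.
have [le_y'x /eqP neq_y'x _] := coversP _ _ _ y'x.
by apply/neq_y'x/(poset_anti le_poset) => //; apply: lub; rewrite // eq_yz.
Qed.

Lemma lower_covers_reducible x :
  is_finite_lattice le -> 1 < #|[set w | covers le w x]| -> reducible le x.
Proof.
case=> _ [_ lattice] /card_gt1P[y [z [/[!inE] yx zx neq_yz]]].
have [le_yx neq_yx _] := coversP _ _ _ yx; have [le_zx neq_zx _] := coversP _ _ _ zx.
have [[j lub_j] _] := lattice y z isT isT; have /is_lubP[yj zj j_min] := lub_j.
apply/reducibleP; exists y, z; split=> //; apply/orP; left.
have [ej|<-//] := covers_between yx yj (j_min _ le_yx le_zx).
rewrite ej in zj; have [ey|ey] := covers_between zx zj le_yx.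
  by rewrite ey eqxx in neq_yz.
by rewrite ey eqxx in neq_yx.
Qed.

End Lattice.

Lemma is_glb_inP (T : finType) (le : rel T) (S : {pred T}) x y m :
  reflect [/\ m \in S, le m x, le m y &
              forall z, z \in S -> le z x -> le z y -> le z m]
          (is_glb_in le S x y m).
Proof. exact: (is_lub_inP (converse le)). Qed.

Lemma comparable_glb_in (T : finType) (le : rel T) (S : {pred T}) x y :
  is_poset le -> x \in S -> y \in S -> le x y || le y x -> exists m, is_glb_in le S x y m.
Proof.
by rewrite orbC => /poset_converse; apply: (comparable_lub_in (le := converse le)).
Qed.

Lemma is_glbP (T : finType) (le : rel T) x y m :
  reflect [/\ le m x, le m y & forall z, le z x -> le z y -> le z m]
          (is_glb le x y m).
Proof. exact: (is_lubP (converse le)). Qed.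

Lemma bypassed_lower_reducible (T : finType) (le : rel T) x p :
  is_poset le -> doubly_irr le x -> bypassed le x -> covers le p x -> reducible le p.
Proof.
move=> le_poset irr [p' [q [y [p'x xq /and4P[p'y yq neq_yp neq_yq] neq_yx]]]] px.
have /andP[_ /card_le1_eqP one_lower] := irr.
have ep : p' = p by apply: one_lower; rewrite inE.
rewrite {}ep {p'x} in p'y neq_yp; have [le_px neq_px _] := coversP _ _ _ px.
apply/reducibleP; exists x, y; rewrite eq_sym neq_px neq_yp; split=> //.
apply/orP; right; apply/is_glbP; split=> // z zx zy.
have [ez|neq_zx] := eqVneq z x; last exact: (le_lower_cover le_poset irr px).
rewrite ez in zx zy; case/eqP: neq_yq; apply: (poset_anti le_poset) => //.
exact: (le_upper_cover le_poset irr xq).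
Qed.

Lemma reducibleE (T : finType) (le : rel T) x :
  is_finite_lattice le -> reducible le x = ~~ doubly_irr le x.
Proof.
move=> le_lattice; have le_poset := proj1 le_lattice.
rewrite /doubly_irr negb_and -!ltnNge -card_lower_covers_converse.
apply/idP/orP => [/reducibleP[y [z [yx zx /orP[lub|glb]]]]|[]].
- by right; apply: lub_lower_covers lub yx zx.
- by left; apply: lub_lower_covers (poset_converse le_poset) glb yx zx.
- move=> ?; rewrite -reducible_converse.
  by apply: lower_covers_reducible => //; apply: finite_lattice_converse.
- exact: lower_covers_reducible.
Qed.

Lemma RC_lattice_converse (T : finType) (le : rel T) :
  is_RC_lattice le -> is_RC_lattice (converse le).
Proof.
case=> le_lattice red_total; split; first exact: finite_lattice_converse.
by move=> x y; rewrite !(reducible_converse le) orbC; apply: red_total.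
Qed.

Section RCLattice.
Variables (T : finType) (le : rel T).
Hypothesis le_RC : is_RC_lattice le.

Notation red := (reducible le).

Let le_poset : is_poset le := proj1 (proj1 le_RC).

Lemma red_total x y : red x -> red y -> le x y || le y x.
Proof. by case: le_RC => _; apply. Qed.

Lemma red_rank_mono x y :
  red x -> le x y -> x != y -> red_rank le x < red_rank le y.
Proof.
move=> red_x xy neq_xy; apply/proper_card/properP; split.
  apply/subsetP => w; rewrite !inE => /and3P[-> wx _].
  rewrite (poset_trans le_poset wx xy); apply: contraNneq neq_xy => ew.
  by apply/eqP/(poset_anti le_poset); rewrite // -ew.
by exists x; rewrite !inE ?red_x ?xy // eqxx andbF.
Qed.

Lemma le_red_rank x y : red x -> red y -> le x y = (red_rank le x <= red_rank le y).
Proof.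
move=> red_x red_y; have [->|neq_xy] := eqVneq x y; first by rewrite leqnn poset_refl.
have [xy|not_xy] := boolP (le x y); first by rewrite ltnW // red_rank_mono.
have yx : le y x by have := red_total red_x red_y; rewrite (negPf not_xy).
by symmetry; rewrite leqNgt red_rank_mono // eq_sym.
Qed.

Lemma red_rank_inj x y : red x -> red y -> red_rank le x = red_rank le y -> x = y.
Proof.
by move=> red_x red_y eq_rank; apply: (poset_anti le_poset); rewrite le_red_rank // eq_rank.
Qed.

Lemma eq_red_rank x y : red x -> red y -> (red_rank le x == red_rank le y) = (x == y).
Proof. by move=> red_x red_y; apply/eqP/eqP => [|-> //]; apply: red_rank_inj. Qed.

Lemma red_rank_lt x : red x -> red_rank le x < num_reducible le.
Proof.
move=> red_x; apply/proper_card/properP; split.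
  by apply/subsetP => w; rewrite !inE => /and3P[].
by exists x; rewrite !inE ?red_x // eqxx !andbF.
Qed.

Lemma red_rank_surj k :
  k < num_reducible le -> exists2 x, red x & red_rank le x = k.
Proof.
move En : (num_reducible le) => n; case: n En => // n En lt_kn.
pose rank_ord x : 'I_n.+1 := inord (red_rank le x).
have rank_ordE x : red x -> val (rank_ord x) = red_rank le x.
  by move=> red_x; rewrite /rank_ord /= inordK // -En red_rank_lt.
have inj : {in [set x | red x] &, injective rank_ord}.
  move=> x y; rewrite !inE => red_x red_y eq_rank.
  by apply: red_rank_inj; rewrite // -!rank_ordE // eq_rank.
have /eqP rank_onto : rank_ord @: [set x | red x] == setT.
  by rewrite eqEcard subsetT cardsT card_ord (card_in_imset inj) -En /=.
have /imsetP[x] : Ordinal lt_kn \in rank_ord @: [set x | red x] by rewrite rank_onto inE.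
by rewrite inE => red_x /(congr1 val) /= ->; exists x; rewrite // -rank_ordE.
Qed.

Lemma ex_red_between u v : red u -> red v ->
  [exists (w | red w), between le u v w] = ((red_rank le u).+1 < red_rank le v).
Proof.
move=> red_u red_v; apply/exists_inP/idP => [[w red_w /and4P[uw wv]]|gap].
  rewrite eq_sym => neq_uw neq_wv.
  exact: leq_ltn_trans (red_rank_mono red_u uw neq_uw) (red_rank_mono red_w wv neq_wv).
have [w red_w rank_w] := red_rank_surj (ltn_trans gap (red_rank_lt red_v)).
exists w; rewrite // /between !le_red_rank // rank_w leqnSn (ltnW gap) /=.
apply/andP; split; last by apply: contraTN gap => /eqP<-; rewrite rank_w ltnn.
by apply: contra_eqN rank_w => /eqP->; rewrite neq_ltn ltnSn.
Qed.

End RCLattice.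

(** * The feet of an irreducible element *)

(* In a block an irreducible element has exactly one lower cover, so that the default of
   [odflt] is not reached. *)
Definition lower_foot (T : finType) (le : rel T) (x : T) : T :=
  if reducible le x then x else odflt x [pick p | covers le p x].

Definition upper_foot (T : finType) (le : rel T) : T -> T := lower_foot (converse le).

Definition feet (T : finType) (le : rel T) (x : T) : T * T :=
  (lower_foot le x, upper_foot le x).

Definition RC_block (T : finType) (le : rel T) : Prop :=
  is_RC_lattice le /\ forall x, ~~ reducible le x -> bypassed le x.

Lemma RC_block_converse (T : finType) (le : rel T) :
  RC_block le -> RC_block (converse le).
Proof.
case=> le_RC bypass; split; first exact: RC_lattice_converse.
by move=> x; rewrite (reducible_converse le) => /bypass/bypassed_converse.
Qed.

Lemma RC_blockP (T : finType) (le : rel T) :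
  is_RC_lattice le -> 1 < #|T| -> basic_block le <-> RC_block le.
Proof.
move=> le_RC T_gt1; have le_lattice := proj1 le_RC.
have [m m_bottom] := bottom_exists le_lattice.
apply: iff_trans (basic_blockP (proj1 le_lattice) m_bottom T_gt1) _.
split=> [bypass|[_ bypass] x irr]; last by apply: bypass; rewrite reducibleE // irr.
by split=> // x; rewrite reducibleE // negbK; apply: bypass.
Qed.

Section LowerFoot.
Variables (T : finType) (le : rel T).
Hypothesis le_block : RC_block le.

Notation red := (reducible le).
Notation lo := (lower_foot le).

Let le_lattice : is_finite_lattice le := proj1 (proj1 le_block).
Let le_poset : is_poset le := proj1 le_lattice.

Lemma irr_doubly_irr x : ~~ red x -> doubly_irr le x.
Proof. by rewrite reducibleE // negbK. Qed.

Lemma lower_foot_id x : red x -> lo x = x.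
Proof. by rewrite /lower_foot => ->. Qed.

Lemma covers_lower_footE x p : ~~ red x -> covers le p x = (p == lo x).
Proof.
move=> irr; have lo_x : covers le (lo x) x.
  have [p' [_ [_ [p'x _ _ _]]]] := proj2 le_block x irr.
  by rewrite /lower_foot (negPf irr); case: pickP => //= /(_ p'); rewrite p'x.
apply/idP/eqP => [px|-> //]; have /andP[_ /card_le1_eqP one_lower] := irr_doubly_irr irr.
by apply: one_lower; rewrite inE.
Qed.

Lemma lower_foot_covers x : ~~ red x -> covers le (lo x) x.
Proof. by move=> irr; rewrite covers_lower_footE. Qed.

Lemma lower_foot_le x : le (lo x) x.
Proof.
have [red_x|irr] := boolP (red x); first by rewrite lower_foot_id // (poset_refl le_poset).
by have /coversP[] := lower_foot_covers irr.
Qed.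

Lemma lower_foot_neq x : ~~ red x -> lo x != x.
Proof. by move/lower_foot_covers/coversP => []. Qed.

Lemma lower_foot_max x y : ~~ red x -> le y x -> y != x -> le y (lo x).
Proof.
move=> irr; apply: (le_lower_cover le_poset (irr_doubly_irr irr)).
exact: lower_foot_covers.
Qed.

Lemma lower_foot_red x : red (lo x).
Proof.
have [red_x|irr] := boolP (red x); first by rewrite lower_foot_id.
exact: bypassed_lower_reducible (irr_doubly_irr irr) (proj2 le_block x irr) (lower_foot_covers irr).
Qed.

Lemma lower_foot_between u v z :
  ~~ red z -> between le u v z -> ~~ between le u v (lo z) -> lo z = u.
Proof.
move=> irr /[dup] uvz /and4P[uz _ neq_zu _].
apply: (between_below le_poset uvz _ (lower_foot_le z)).
by rewrite lower_foot_max // eq_sym.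
Qed.

End LowerFoot.

Section Block.
Variables (T : finType) (le : rel T).
Hypothesis le_block : RC_block le.

Notation red := (reducible le).
Notation lo := (lower_foot le).
Notation hi := (upper_foot le).

Let le_RC : is_RC_lattice le := proj1 le_block.
Let le_poset : is_poset le := proj1 (proj1 le_RC).
Let ge_block : RC_block (converse le) := RC_block_converse le_block.

Lemma upper_foot_id x : red x -> hi x = x.
Proof. by rewrite -reducible_converse; apply: lower_foot_id. Qed.

Lemma covers_upper_footE x q : ~~ red x -> covers le x q = (q == hi x).
Proof. rewrite -reducible_converse -covers_converse; exact: covers_lower_footE. Qed.

Lemma upper_foot_covers x : ~~ red x -> covers le x (hi x).
Proof. by move=> irr; rewrite covers_upper_footE. Qed.

Lemma upper_foot_le x : le x (hi x).
Proof. exact: (lower_foot_le ge_block). Qed.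

Lemma upper_foot_min x y : ~~ red x -> le x y -> y != x -> le (hi x) y.
Proof. rewrite -reducible_converse; exact: (lower_foot_max ge_block). Qed.

Lemma upper_foot_red x : red (hi x).
Proof. by rewrite -reducible_converse; apply: lower_foot_red. Qed.

Lemma upper_foot_between u v z :
  ~~ red z -> between le u v z -> ~~ between le u v (hi z) -> hi z = v.
Proof.
rewrite -reducible_converse -!(between_converse le).
exact: lower_foot_between.
Qed.

Lemma feet_red x : (lo x == hi x) = red x.
Proof.
have [red_x|irr] := boolP (red x); first by rewrite lower_foot_id // upper_foot_id // eqxx.
apply: contraNF (lower_foot_neq le_block irr) => /eqP eq_feet.
by apply/eqP/(poset_anti le_poset); rewrite ?lower_foot_le // eq_feet upper_foot_le.
Qed.

Lemma le_feet x y : le x y -> x != y -> le (hi x) (lo y).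
Proof.
move=> xy neq_xy; have hi_y : le (hi x) y.
  have [red_x|irr] := boolP (red x); first by rewrite upper_foot_id.
  by apply: upper_foot_min; rewrite // eq_sym.
have [red_y|irr] := boolP (red y); first by rewrite lower_foot_id.
by apply: lower_foot_max => //; apply: contraNneq irr => <-; apply: upper_foot_red.
Qed.

Lemma leE x y : le x y = (x == y) || le (hi x) (lo y).
Proof.
have [->|neq_xy] := eqVneq x y; first exact: (poset_refl le_poset).
apply/idP/idP => [xy|hi_lo]; first exact: le_feet.
apply: (poset_trans le_poset) (lower_foot_le le_block y).
exact: (poset_trans le_poset) (upper_foot_le x) hi_lo.
Qed.

Lemma same_feet_incomparable x y :
  ~~ red x -> feet le x = feet le y -> x != y -> ~~ le x y.
Proof.
move=> irr [eq_lo _] neq_xy; apply: contra (lower_foot_neq le_block irr) => xy.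
apply/eqP/(poset_anti le_poset); first exact: lower_foot_le.
by rewrite eq_lo; apply: (poset_trans le_poset) (upper_foot_le x) (le_feet xy neq_xy).
Qed.

Lemma between_feet_incomparable x w :
  ~~ red x -> between le (lo x) (hi x) w -> w != x -> ~~ le x w && ~~ le w x.
Proof.
move=> irr /and4P[lo_w w_hi neq_lo neq_hi] neq_wx; apply/andP; split.
  by apply: contra neq_hi => xw; apply/eqP/(poset_anti le_poset); rewrite // upper_foot_min.
by apply: contra neq_lo => wx; apply/eqP/(poset_anti le_poset); rewrite // lower_foot_max.
Qed.

Lemma foot_twin x : ~~ red x ->
  (forall w, red w -> ~~ between le (lo x) (hi x) w) ->
  exists2 y, y != x & feet le y = feet le x.
Proof.
move=> irr no_red; have [p [q [y [+ + pqy neq_yx]]]] := proj2 le_block x irr.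
rewrite covers_lower_footE // covers_upper_footE // => /eqP p_lo /eqP q_hi.
rewrite {}p_lo {}q_hi in pqy.
have irr_y : ~~ red y by apply: contraL pqy => /no_red.
exists y => //; congr pair.
  by apply: lower_foot_between pqy _; rewrite // no_red // lower_foot_red.
by apply: upper_foot_between pqy _; rewrite // no_red // upper_foot_red.
Qed.

Lemma lub_upper_foot u y z :
  is_lub le y z u -> y != u -> z != u -> exists2 x, ~~ red x & hi x = u.
Proof.
wlog hi_yz : y z / le (hi y) (hi z).
  move=> IH /[dup] lub /is_lubP[yu zu u_min] neq_yu neq_zu.
  have /orP[hi_yz|hi_zy] := red_total le_RC (upper_foot_red y) (upper_foot_red z).
    exact: IH hi_yz lub neq_yu neq_zu.
  apply: IH hi_zy _ neq_zu neq_yu; apply/is_lubP; split=> // w zw yw; exact: u_min.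
move=> lub neq_yu neq_zu; have red_u : red u by apply/reducibleP; exists y, z; rewrite lub.
have /is_lubP[yu zu u_min] := lub.
have hi_z : hi z = u.
  apply: (poset_anti le_poset).
    by rewrite -[u in le _ u](lower_foot_id red_u) le_feet.
  by apply: u_min (upper_foot_le z); apply: (poset_trans le_poset) (upper_foot_le y) hi_yz.
by exists z => //; apply: contra neq_zu => red_z; rewrite -hi_z upper_foot_id.
Qed.

End Block.

Lemma red_foot (T : finType) (le : rel T) u : RC_block le -> reducible le u ->
  exists2 z, ~~ reducible le z & lower_foot le z = u \/ upper_foot le z = u.
Proof.
move=> le_block /reducibleP[y [z [neq_yu neq_zu /orP[lub|glb]]]].
  have [x irr hi_x] := lub_upper_foot le_block lub neq_yu neq_zu.
  by exists x; last right.
have [x irr lo_x] := lub_upper_foot (RC_block_converse le_block) glb neq_yu neq_zu.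
by exists x; [rewrite -reducible_converse|left].
Qed.

(** * Adjunct representations *)

Lemma adj_rep_converse (T : finType) (le : rel T) r c a b :
  adj_rep le r c a b -> adj_rep (converse le) r c b a.
Proof.
case=> c_le [root [chain0 [max0 step]]]; split=> //; split=> //; split.
  by move=> x y cx cy; rewrite orbC chain0.
split=> [y y_comp|i /step].
  by apply: max0 => x cx; rewrite orbC; apply: y_comp.
case=> new [chain [lattice [ca [cb [ab [neq_ab [[z [cz [za [zb [az zb']]]]] [below above]]]]]]]].
split=> //; split; first by move=> x y cx cy; rewrite orbC chain.
split; first exact: lattice_on_converse.
split=> //; split=> //; split=> //; split; first exact/nesym.
split; first by exists z.
by split=> x y cx cy; [apply: above|apply: below].
Qed.

Section AdjunctChains.
Variables (T : finType) (le : rel T) (r : nat) (c : T -> nat) (a b : nat -> T).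
Hypothesis le_poset : is_poset le.
Hypothesis rep : adj_rep le r c a b.

Lemma chain_comparable x y : c x = c y -> le x y || le y x.
Proof.
case: rep => c_le [_ [chain0 [_ step]]] eq_c; have [c0|c_gt0] := posnP (c y).
  by apply: chain0; rewrite ?eq_c.
by have [|_ [chain _]] := step (c y); [rewrite c_gt0 c_le|apply: chain].
Qed.

Lemma adjoined_index x : 0 < c x -> 0 < c x <= r.
Proof. by move=> ->; case: rep => c_le _; apply: c_le. Qed.

Lemma adjunct_step k : 0 < k <= r ->
  [/\ c (a k) < k, c (b k) < k, exists w, c w = k &
      exists2 z, c z < k & between le (a k) (b k) z].
Proof.
case: rep => _ [_ [_ [_ step]]] /step.
case=> new [_ [_ [ca [cb [_ [_ [[z [cz [/eqP za [/eqP zb [az zb']]]]] _]]]]]]].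
by split=> //; exists z => //; apply/and4P.
Qed.

Lemma le_adjoined x y : c x < c y -> le x y = le x (a (c y)).
Proof.
case: rep => c_le [_ [_ [_ step]]] cxy.
have [|_ [_ [_ [_ [_ [_ [_ [_ [below _]]]]]]]]] := step (c y); last exact: below.
by rewrite c_le andbT; apply: leq_ltn_trans cxy.
Qed.

Lemma adjunct_lower_le x : 0 < c x -> le (a (c x)) x.
Proof.
by move=> /adjoined_index/adjunct_step[ca _ _ _]; rewrite le_adjoined // poset_refl.
Qed.

End AdjunctChains.

Section LowerAdjunct.
Variables (T : finType) (le : rel T) (r : nat) (c : T -> nat) (a b : nat -> T).
Hypothesis le_poset : is_poset le.
Hypothesis rep : adj_rep le r c a b.

Let ge_rep : adj_rep (converse le) r c b a := adj_rep_converse rep.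

Lemma adjoined_le x y : c x < c y -> le y x = le (b (c y)) x.
Proof. exact: (le_adjoined ge_rep). Qed.

Lemma adjunct_upper_ge x : 0 < c x -> le x (b (c x)).
Proof. exact: (adjunct_lower_le (poset_converse le_poset) ge_rep). Qed.

Lemma old_not_le_new k x z :
  c x = k -> c z < k -> between le (a k) (b k) z -> ~~ le z x.
Proof.
move=> cx cz /and4P[az _ neq_za _]; rewrite (le_adjoined rep) cx //.
by apply: contra neq_za => za; apply/eqP/(poset_anti le_poset).
Qed.

(* A common lower bound of the old [z] and the new [w] that lies on a later chain may be
   replaced by the upper end of the pair of that chain, hence the induction on the index. *)
Lemma adjunct_lower_red k : 0 < k <= r -> reducible le (a k).
Proof.
move=> k_range; have [ca cb [w cw] [z cz akz]] := adjunct_step rep k_range.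
have k_gt0 : 0 < c w by rewrite cw; case/andP: k_range.
have aw := adjunct_lower_le le_poset rep k_gt0; rewrite cw in aw.
have /and4P[az zb neq_za neq_zb] := akz.
apply/reducibleP; exists z, w; split=> //.
  by apply: contraTneq ca => <-; rewrite cw ltnn.
apply/orP; right; apply/is_glbP; split=> // m.
have [i] := ubnP (c m); elim: i m => // i IH m cm mz mw.
have [mk|km|mk] := ltngtP (c m) k.
- by rewrite (le_adjoined rep) cw in mw.
- have cm_gt0 : 0 < c m by apply: leq_ltn_trans km.
  have [_ cbm _ _] := adjunct_step rep (adjoined_index rep cm_gt0).
  apply: (poset_trans le_poset (adjunct_upper_ge cm_gt0)); apply: IH.
  + exact: leq_trans cbm _.
  + by rewrite -adjoined_le //; apply: ltn_trans km.
  + by rewrite -adjoined_le // cw.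
- rewrite adjoined_le mk // in mz.
  by case/eqP: neq_zb; apply: (poset_anti le_poset).
Qed.

End LowerAdjunct.

Section LowerFootIndex.
Variables (T : finType) (le : rel T) (r : nat) (c : T -> nat) (a b : nat -> T).
Hypothesis le_block : RC_block le.
Hypothesis rep : adj_rep le r c a b.

Notation red := (reducible le).
Notation lo := (lower_foot le).

Let le_poset : is_poset le := proj1 (proj1 (proj1 le_block)).

Lemma adjunct_upper_red k : 0 < k <= r -> red (b k).
Proof.
rewrite -reducible_converse.
exact: (adjunct_lower_red (poset_converse le_poset) (adj_rep_converse rep)).
Qed.

Lemma lower_foot_index z : ~~ red z -> c (lo z) <= c z.
Proof.
move=> irr; rewrite leqNgt; apply/negP => lt_c.
have c_gt0 : 0 < c (lo z) by apply: leq_ltn_trans lt_c.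
have j_range := adjoined_index rep c_gt0; have [_ cb _ _] := adjunct_step rep j_range.
have lo_b := adjunct_upper_ge le_poset rep c_gt0.
have b_lo : le (b (c (lo z))) (lo z).
  apply: lower_foot_max => //; last by apply: contraNneq irr => <-; apply: adjunct_upper_red.
  by rewrite -(adjoined_le rep) // lower_foot_le.
by rewrite -(poset_anti le_poset lo_b b_lo) ltnn in cb.
Qed.

Lemma lower_foot_adjunct z : ~~ red z -> c (lo z) < c z -> a (c z) = lo z.
Proof.
move=> irr lt_c; have c_gt0 : 0 < c z by apply: leq_ltn_trans lt_c.
apply: (poset_anti le_poset); last by rewrite -(le_adjoined rep) // lower_foot_le.
apply: lower_foot_max => //; first exact: (adjunct_lower_le le_poset rep c_gt0).
apply: contraNneq irr => <-.
exact: (adjunct_lower_red le_poset rep (adjoined_index rep c_gt0)).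
Qed.

End LowerFootIndex.

Section AdjunctPairs.
Variables (T : finType) (le : rel T) (r : nat) (c : T -> nat) (a b : nat -> T).
Hypothesis le_block : RC_block le.
Hypothesis rep : adj_rep le r c a b.

Notation red := (reducible le).
Notation lo := (lower_foot le).
Notation hi := (upper_foot le).

Let le_RC : is_RC_lattice le := proj1 le_block.
Let le_poset : is_poset le := proj1 (proj1 le_RC).
Let ge_block : RC_block (converse le) := RC_block_converse le_block.
Let ge_rep : adj_rep (converse le) r c b a := adj_rep_converse rep.

Lemma upper_foot_index z : ~~ red z -> c (hi z) <= c z.
Proof. rewrite -reducible_converse; exact: (lower_foot_index ge_block ge_rep). Qed.

Lemma upper_foot_adjunct z : ~~ red z -> c (hi z) < c z -> b (c z) = hi z.
Proof. rewrite -reducible_converse; exact: (lower_foot_adjunct ge_block ge_rep). Qed.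

Lemma new_not_le_old k x z :
  c x = k -> c z < k -> between le (a k) (b k) z -> ~~ le x z.
Proof.
rewrite -(between_converse le).
exact: (old_not_le_new (poset_converse le_poset) ge_rep).
Qed.

(* New and old elements of the interval are incomparable, so one of the two groups
   contains no reducible element. *)
Lemma adjunct_pair_feet k : 0 < k <= r ->
  exists2 z, ~~ red z & feet le z = (a k, b k).
Proof.
move=> k_range; have [ca cb [w cw] [z cz akz]] := adjunct_step rep k_range.
have [/exists_inP[x red_x /eqP cx]|/exists_inPn no_red] :=
  boolP [exists (x | red x), c x == k].
  have old_irr u : c u < k -> between le (a k) (b k) u -> ~~ red u.
    move=> cu aku; apply/negP => /(red_total le_RC red_x)/orP[]; apply/negP.
      exact: new_not_le_old aku.
    exact: (old_not_le_new le_poset rep cx).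
  have irr := old_irr z cz akz; exists z => //; congr pair.
    apply: (lower_foot_between le_block irr akz).
    apply: contraL (lower_foot_red le_block z) => /old_irr; apply.
    exact: leq_ltn_trans (lower_foot_index le_block rep irr) cz.
  apply: (upper_foot_between le_block irr akz).
  apply: contraL (upper_foot_red le_block z) => /old_irr; apply.
  exact: leq_ltn_trans (upper_foot_index irr) cz.
have irr : ~~ red w by apply: contraL (introT eqP cw) => /no_red.
have red_lo := lower_foot_red le_block w; have red_hi := upper_foot_red le_block w.
have c_lo : c (lo w) < c w.
  by rewrite ltn_neqAle (lower_foot_index le_block rep irr) cw (no_red _ red_lo).
have c_hi : c (hi w) < c w by rewrite ltn_neqAle upper_foot_index // cw (no_red _ red_hi).
by exists w; rewrite // -cw (lower_foot_adjunct le_block rep irr c_lo) upper_foot_adjunct.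
Qed.

(* A grounded irreducible element is a whole chain by itself, adjoined at its feet. *)
Definition grounded (z : T) : bool := (c (lo z) < c z) && (c (hi z) < c z).

Lemma grounded_pair z : ~~ red z -> grounded z ->
  0 < c z <= r /\ (a (c z), b (c z)) = feet le z.
Proof.
move=> irr /andP[c_lo c_hi]; split.
  by apply: (adjoined_index rep); apply: leq_ltn_trans c_lo.
by rewrite (lower_foot_adjunct le_block rep irr c_lo) upper_foot_adjunct.
Qed.

Lemma feet_irr x y : ~~ red x -> feet le y = feet le x -> ~~ red y.
Proof. by rewrite -!(feet_red le_block) => irr [-> ->]. Qed.

Lemma same_feet_chain x y :
  ~~ red x -> feet le x = feet le y -> c x = c y -> x = y.
Proof.
move=> irr eq_feet /(chain_comparable rep); apply: contraTeq => neq_xy.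
have irr_y := feet_irr irr (esym eq_feet).
rewrite negb_or same_feet_incomparable //=.
by rewrite same_feet_incomparable // eq_sym.
Qed.

Lemma ungrounded_uniq x y : ~~ red x -> feet le x = feet le y ->
  ~~ grounded x -> ~~ grounded y -> x = y.
Proof.
move=> irr eq_feet; have irr_y := feet_irr irr (esym eq_feet); have [eq_lo eq_hi] := eq_feet.
rewrite /grounded eq_lo eq_hi => ungr_x ungr_y; apply: same_feet_chain => //.
have := lower_foot_index le_block rep irr; have := upper_foot_index irr.
have := lower_foot_index le_block rep irr_y; have := upper_foot_index irr_y.
rewrite eq_lo eq_hi; lia.
Qed.

Lemma ungrounded_older z w : ~~ red z -> ~~ grounded z -> red w ->
  between le (lo z) (hi z) w -> c z < c w.
Proof.
move=> irr ungr red_w zw; have neq_wz : w != z by apply: contraNneq irr => <-.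
have /andP[not_zw not_wz] := between_feet_incomparable le_block irr zw neq_wz.
have /and4P[lo_w w_hi _ _] := zw.
rewrite ltnNge leq_eqVlt; apply/negP => /orP[/eqP/(chain_comparable rep)|c_wz].
  by rewrite (negPf not_zw) (negPf not_wz).
have c_gt0 : 0 < c z by apply: leq_ltn_trans c_wz.
move: ungr; rewrite negb_and -!leqNgt => /orP[c_lo|c_hi].
  have eq_c : c (lo z) = c z by apply/eqP; rewrite eqn_leq c_lo (lower_foot_index le_block rep).
  rewrite (adjoined_le rep) eq_c // in lo_w; case/negP: not_zw.
  exact: (poset_trans le_poset (adjunct_upper_ge le_poset rep c_gt0) lo_w).
have eq_c : c (hi z) = c z by apply/eqP; rewrite eqn_leq c_hi upper_foot_index.
rewrite (le_adjoined rep) eq_c // in w_hi; case/negP: not_wz.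
exact: (poset_trans le_poset w_hi (adjunct_lower_le le_poset rep c_gt0)).
Qed.

(* The oldest reducible element strictly between the feet lies on a chain adjoined there. *)
Lemma ungrounded_pair z w0 : ~~ red z -> ~~ grounded z ->
  red w0 -> between le (lo z) (hi z) w0 ->
  exists w, [/\ red w, between le (lo z) (hi z) w,
                0 < c w <= r & (a (c w), b (c w)) = feet le z].
Proof.
move=> irr ungr red_w0 zw0.
pose candidate w := red w && between le (lo z) (hi z) w.
have candidate_w0 : candidate w0 by apply/andP.
have [w /andP[red_w zw] w_oldest] := arg_minnP c candidate_w0.
have c_zw := ungrounded_older irr ungr red_w zw.
have c_gt0 : 0 < c w by apply: leq_ltn_trans c_zw.
have w_range := adjoined_index rep c_gt0; have [ca cb _ _] := adjunct_step rep w_range.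
have older_not_between u : red u -> c u < c w -> ~~ between le (lo z) (hi z) u.
  move=> red_u; apply: contraL => zu.
  by rewrite -leqNgt w_oldest // /candidate red_u.
have /and4P[lo_w w_hi _ _] := zw.
exists w; split=> //; congr pair.
  apply: (between_below le_poset zw _ (adjunct_lower_le le_poset rep c_gt0)).
    by rewrite -(le_adjoined rep) //; apply: leq_ltn_trans (lower_foot_index le_block rep irr) c_zw.
  by apply: older_not_between ca; apply: (adjunct_lower_red le_poset rep w_range).
apply: (between_above le_poset zw (adjunct_upper_ge le_poset rep c_gt0)).
  by rewrite -(adjoined_le rep) //; apply: leq_ltn_trans (upper_foot_index irr) c_zw.
by apply: older_not_between cb; apply: (adjunct_upper_red le_block rep w_range).
Qed.

Lemma foot_pair z : ~~ red z -> exists2 i, 0 < i <= r & (a i, b i) = feet le z.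
Proof.
move=> irr; have [gr|ungr] := boolP (grounded z).
  by have [c_range pairE] := grounded_pair irr gr; exists (c z).
have [/exists_inP[w red_w zw]|/exists_inPn no_red] :=
  boolP [exists (w | red w), between le (lo z) (hi z) w].
  by have [w' [_ _ c_range pairE]] := ungrounded_pair irr ungr red_w zw; exists (c w').
have [y neq_yz eq_feet] := foot_twin le_block irr no_red.
have irr_y := feet_irr irr eq_feet.
have gr : grounded y by apply: contraNT neq_yz => ?; apply/eqP/ungrounded_uniq.
by have [c_range pairE] := grounded_pair irr_y gr; exists (c y); rewrite // pairE.
Qed.

Section DistinctPairs.
Hypothesis distinct : forall i j,
  0 < i <= r -> 0 < j <= r -> a i = a j -> b i = b j -> i = j.

Lemma grounded_inj z : ~~ red z ->
  {in [set x | feet le x == feet le z] &, injective grounded}.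
Proof.
move=> irr x y; rewrite !inE => /eqP xz /eqP yz eq_gr.
have irr_x := feet_irr irr xz; have irr_y := feet_irr irr yz.
have eq_feet : feet le x = feet le y by rewrite xz.
have [gr_x|ungr_x] := boolP (grounded x); last first.
  by apply: ungrounded_uniq; rewrite // -eq_gr.
have [x_range x_pair] := grounded_pair irr_x gr_x.
have [|y_range y_pair] := grounded_pair irr_y; first by rewrite -eq_gr.
apply: same_feet_chain => //.
by have [] : (a (c x), b (c x)) = (a (c y), b (c y)); [rewrite x_pair y_pair|apply: distinct].
Qed.

Lemma red_between_grounded x y w : ~~ red x -> feet le x = feet le y ->
  red w -> between le (lo x) (hi x) w -> grounded y -> grounded x.
Proof.
move=> irr eq_feet red_w xw gr_y; apply: contraT => ungr.
have irr_y := feet_irr irr (esym eq_feet).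
have [v [red_v xv v_range v_pair]] := ungrounded_pair irr ungr red_w xw.
have [y_range y_pair] := grounded_pair irr_y gr_y.
have neq_vy : v != y by apply: contraNneq irr_y => <-.
have /(chain_comparable rep) : c v = c y.
  by have [] : (a (c v), b (c v)) = (a (c y), b (c y));
    [rewrite v_pair y_pair eq_feet|apply: distinct].
have [eq_lo eq_hi] := eq_feet; rewrite eq_lo eq_hi in xv.
by have /andP[/negPf-> /negPf->] := between_feet_incomparable le_block irr_y xv neq_vy.
Qed.

Lemma card_feet_fiber z : ~~ red z ->
  #|[set x | feet le x == feet le z]| =
  (~~ [exists (w | red w), between le (lo z) (hi z) w]).+1.
Proof.
move=> irr; set fiber := [set x | _].
have z_fiber : z \in fiber by rewrite inE.
have [/exists_inP[w red_w zw]|/exists_inPn no_red] :=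
  boolP [exists (w | red w), between le (lo z) (hi z) w].
  apply/eqP/cards1P; exists z; apply/eqP; rewrite eqEsubset sub1set z_fiber andbT.
  apply/subsetP => x /[dup] x_fiber; rewrite !inE => /eqP eq_feet; have [eq_lo eq_hi] := eq_feet.
  apply/eqP/(grounded_inj irr); rewrite // -!/fiber //; apply/idP/idP.
    exact: red_between_grounded red_w zw.
  apply: red_between_grounded red_w _; rewrite ?eq_lo ?eq_hi //.
  exact: feet_irr irr eq_feet.
have [y neq_yz eq_feet] := foot_twin le_block irr no_red.
apply/eqP; rewrite eqn_leq; apply/andP; split.
  by rewrite -(card_in_imset (grounded_inj irr)) -card_bool max_card.
by apply/card_gt1P; exists y, z; rewrite !inE eq_feet.
Qed.

End DistinctPairs.
End AdjunctPairs.

(** * Fundamental basic blocks *)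

Definition foot_rank (T : finType) (le : rel T) (x : T) : nat * nat :=
  (red_rank le (lower_foot le x), red_rank le (upper_foot le x)).

Definition foot_arc (T : finType) (le : rel T) (i j : nat) : bool :=
  [exists (z | ~~ reducible le z), foot_rank le z == (i, j)].

(* Only another irreducible element can bypass one whose feet are consecutive. *)
Definition foot_multiplicity (p : nat * nat) : nat :=
  if p.1 == p.2 then 1 else (p.2 == p.1.+1).+1.

Definition foot_order (T : eqType) (foot : T -> nat * nat) : rel T :=
  fun x y => (x == y) || ((foot x).2 <= (foot y).1).

Definition block_digraph (T : finType) (le : rel T) (n : nat) : {set 'I_n * 'I_n} :=
  [set p : 'I_n * 'I_n | foot_arc le p.1 p.2].

Section FootRank.
Variables (T : finType) (le : rel T).
Hypothesis le_block : RC_block le.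

Notation red := (reducible le).
Notation rk := (red_rank le).
Notation lo := (lower_foot le).
Notation hi := (upper_foot le).

Let le_RC : is_RC_lattice le := proj1 le_block.
Let lo_red x : red (lo x) := lower_foot_red le_block x.
Let hi_red x : red (hi x) := upper_foot_red le_block x.

Lemma foot_rank_id x : red x -> foot_rank le x = (rk x, rk x).
Proof. by move=> red_x; rewrite /foot_rank lower_foot_id // upper_foot_id. Qed.

Lemma le_foot_order : le =2 foot_order (foot_rank le).
Proof. by move=> x y; rewrite (leE le_block) (le_red_rank le_RC). Qed.

Lemma foot_rank_le x : (foot_rank le x).1 <= (foot_rank le x).2 ?= iff red x.
Proof.
split; last by rewrite (eq_red_rank le_RC) ?feet_red.
rewrite -(le_red_rank le_RC (lo_red x) (hi_red x)).
by apply: (poset_trans (proj1 (proj1 le_RC))) (upper_foot_le le_block x); apply: lower_foot_le.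
Qed.

Lemma foot_rank_irr x y : ~~ red x -> foot_rank le y = foot_rank le x -> ~~ red y.
Proof. by rewrite -!foot_rank_le => irr ->. Qed.

Lemma foot_rank_lt x :
  (foot_rank le x).1 < num_reducible le /\ (foot_rank le x).2 < num_reducible le.
Proof. by split; apply: red_rank_lt. Qed.

Lemma eq_foot_rank x y : (foot_rank le x == foot_rank le y) = (feet le x == feet le y).
Proof. by rewrite /foot_rank /feet xpair_eqE [RHS]xpair_eqE 2?(eq_red_rank le_RC). Qed.

Lemma red_covers u v : red u -> red v ->
  covers le u v = (rk v == (rk u).+1) && ~~ foot_arc le (rk u) (rk v).
Proof.
move=> red_u red_v; have le_poset := proj1 (proj1 le_RC).
apply/idP/andP => [uv|[/eqP consecutive /exists_inPn no_arc]].
  have [le_uv neq_uv no_between] := coversP _ _ _ uv; split.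
    rewrite eqn_leq (red_rank_mono le_RC) // andbT leqNgt -(ex_red_between le_RC) //.
    by apply/exists_inPn => w _; apply: no_between.
  apply/exists_inPn => z irr.
  apply: contra (no_between z) => /eqP[eq_lo eq_hi].
  rewrite -(red_rank_inj le_RC (lo_red z) red_u eq_lo) -(red_rank_inj le_RC (hi_red z) red_v eq_hi).
  rewrite /between (lower_foot_le le_block) (upper_foot_le le_block) /=.
  by apply/andP; split; apply: contraNneq irr => ->.
have /exists_inPn no_red : ~~ [exists (w | red w), between le u v w].
  by rewrite (ex_red_between le_RC) // consecutive ltnn.
apply/coversP; split=> [||w]; first by rewrite (le_red_rank le_RC) // consecutive.
  by apply: contra_eq_neq consecutive => ->; rewrite neq_ltn ltnSn.
have [/no_red//|irr] := boolP (red w); apply: contra (no_arc w irr) => uwv.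
rewrite /foot_rank (lower_foot_between le_block irr uwv (no_red _ (lo_red w))).
by rewrite (upper_foot_between le_block irr uwv (no_red _ (hi_red w))).
Qed.

End FootRank.

Definition consecutive (n : nat) (p : 'I_n * 'I_n) : bool := p.2 == p.1.+1 :> nat.

Lemma card_consecutive n : #|[set p : 'I_n * 'I_n | consecutive p]| = n.-1.
Proof.
case: n => [|n]; first by apply: eq_card0 => -[[]].
pose step (i : 'I_n) := (widen_ord (leqnSn n) i, lift ord0 i).
rewrite -[RHS]card_ord -[RHS](card_imset _ (_ : injective step)); last first.
  by move=> i j [/val_inj].
apply: eq_card => -[i j]; rewrite inE; apply/eqP/imsetP => /= [ij|[k _ [-> ->]] //].
have lt_in : i < n by rewrite -ltnS -ij.
by exists (Ordinal lt_in) => //; congr pair; apply: val_inj.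
Qed.

Section FundamentalBlock.
Variables (T : finType) (le : rel T) (n : nat).
Hypothesis le_fund : fundamental_basic_block le.
Hypothesis num_red : num_reducible le = n.
Hypothesis n_gt1 : 1 < n.

Notation red := (reducible le).
Notation rk := (red_rank le).
Notation lo := (lower_foot le).
Notation hi := (upper_foot le).

Let le_RC : is_RC_lattice le := proj1 le_fund.

Lemma fundamental_RC_block : RC_block le.
Proof.
apply/RC_blockP => //; first by apply: leq_trans n_gt1 _; rewrite -num_red max_card.
by case: le_fund => _ [].
Qed.

Let le_block := fundamental_RC_block.
Let lo_red x : red (lo x) := lower_foot_red le_block x.
Let hi_red x : red (hi x) := upper_foot_red le_block x.

Lemma GF_arcP (i j : 'I_n) : reflect (GF_arc le i j) (foot_arc le i j).
Proof.
apply: (iffP exists_inP) => [[z irr /eqP[rk_lo rk_hi]]|].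
  exists (lo z), (hi z); rewrite lo_red hi_red rk_lo rk_hi !eqxx; split=> //.
  case: le_fund => _ [_ [r [c [a [b [rep _]]]]]].
  have [k k_range [eq_a eq_b]] := foot_pair le_block rep irr.
  by exists r, c, a, b; split=> //; exists k.
case=> x [y [/and4P[_ _ /eqP rk_x /eqP rk_y] [r [c [a [b [rep [k [k_range [ak bk]]]]]]]]]].
have [z irr [lo_z hi_z]] := adjunct_pair_feet le_block rep k_range.
by exists z; rewrite // /foot_rank lo_z hi_z ak bk rk_x rk_y.
Qed.

Lemma card_foot_rank_fiber z :
  #|[set x | foot_rank le x == foot_rank le z]| = foot_multiplicity (foot_rank le z).
Proof.
rewrite /foot_multiplicity (foot_rank_le le_block); have [red_z|irr] := boolP (red z).
  apply/eqP/cards1P; exists z; apply/setP => x; rewrite !inE.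
  apply/eqP/eqP => [eq_xz|-> //].
  have red_x : red x by rewrite -(foot_rank_le le_block) eq_xz foot_rank_le.
  by move: eq_xz; rewrite !foot_rank_id // => -[/(red_rank_inj le_RC)->].
have -> : [set x | foot_rank le x == foot_rank le z] = [set x | feet le x == feet le z].
  by apply/setP => x; rewrite !inE eq_foot_rank.
case: le_fund => _ [_ [r [c [a [b [rep distinct]]]]]].
rewrite (card_feet_fiber le_block rep distinct irr) (ex_red_between le_RC) // -leqNgt.
by rewrite [in RHS]eqn_leq (ltn_leqif (foot_rank_le le_block z)) irr andbT.
Qed.

Lemma lower_covers_arc y z i : red y -> ~~ red z -> foot_rank le z = (i, rk y) ->
  [set x | covers le x y & rk (lo x) == i] = [set x | foot_rank le x == foot_rank le z].
Proof.
move=> red_y irr foot_z; have arc_z : foot_arc le i (rk y).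
  by apply/exists_inP; exists z; rewrite // foot_z.
apply/setP => x; rewrite !inE foot_z; have [red_x|irr_x] := boolP (red x); last first.
  rewrite covers_upper_footE // xpair_eqE andbC (eq_red_rank le_RC) //.
  by congr (_ && _); apply: eq_sym.
rewrite red_covers // lower_foot_id //; apply/idP/idP => [|foot_x].
  by case/andP=> /andP[_ no_arc] /eqP eq_i; rewrite eq_i arc_z in no_arc.
have := foot_rank_irr le_block irr (y := x); rewrite red_x foot_z => /(_ _)/negP[] //.
exact/eqP.
Qed.

Lemma lower_covers_no_arc x y i : red y -> ~~ foot_arc le i (rk y) ->
  covers le x y && (rk (lo x) == i) = [&& red x, rk x == i & rk y == i.+1].
Proof.
move=> red_y no_arc; have [red_x|irr_x] /= := boolP (red x).
  rewrite red_covers // lower_foot_id //.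
  by have [->|] := eqVneq (rk x) i; rewrite ?andbF // no_arc !andbT.
rewrite covers_upper_footE //; apply: contraNF no_arc => /andP[/eqP-> /eqP<-].
by apply/exists_inP; exists x.
Qed.

(* For [rk y = i.+1] the additional cover is the twin when there is an arc, and the reducible
   element of rank [i] otherwise. *)
Lemma card_lower_covers_foot y i : red y ->
  #|[set x | covers le x y & rk (lo x) == i]| = foot_arc le i (rk y) + (rk y == i.+1).
Proof.
move=> red_y; have [/exists_inP[z irr /eqP foot_z]|no_arc] := boolP (foot_arc le i (rk y)).
  rewrite (lower_covers_arc red_y irr foot_z) card_foot_rank_fiber.
  by rewrite /foot_multiplicity (foot_rank_le le_block) (negPf irr) foot_z.
have [consecutive|not_consecutive] := eqVneq (rk y) i.+1; last first.
  by apply: eq_card0 => x; rewrite inE lower_covers_no_arc // (negPf not_consecutive) !andbF.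
have [|u red_u rk_u] := red_rank_surj le_RC (k := i).
  by apply: leq_trans (red_rank_lt red_y); rewrite consecutive.
apply/eqP/cards1P; exists u; apply/setP => x.
rewrite !inE lower_covers_no_arc // consecutive eqxx andbT -rk_u.
by apply/andP/eqP => [[red_x /eqP/(red_rank_inj le_RC)->]|->].
Qed.

Lemma mem_block_digraph (i j : 'I_n) : (i, j) \in block_digraph le n <-> GF_arc le i j.
Proof. by rewrite inE; apply: iff_sym (rwP (GF_arcP i j)). Qed.

Lemma Dgraph_block_digraph : Dgraph #|block_digraph le n| (block_digraph le n).
Proof.
apply/and3P; split=> //.
  apply/forall_inP => p; rewrite inE => /exists_inP[z irr /eqP foot_z].
  by have := ltn_leqif (foot_rank_le le_block z); rewrite irr foot_z => ->.
apply/forallP => v; have [|u red_u rk_u] := @red_rank_surj _ _ le_RC v; first by rewrite num_red.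
have [z irr feet_z] := red_foot le_block red_u.
have [lt_lo lt_hi] := foot_rank_lt le_block z; rewrite num_red in lt_lo lt_hi.
apply/exists_inP; exists (Ordinal lt_lo, Ordinal lt_hi).
  by rewrite inE; apply/exists_inP; exists z.
by case: feet_z rk_u => <- rk_z; rewrite -!val_eqE /= rk_z eqxx ?orbT.
Qed.

Lemma card_covers_irr :
  #|[set e : T * T | covers le e.1 e.2 & ~~ red e.2]| = #|[set x | ~~ red x]|.
Proof.
rewrite -[RHS](card_imset _ (_ : injective (fun y => (lo y, y)))); last by move=> ? ? [].
apply: eq_card => -[x y]; rewrite inE; apply/andP/imsetP => /= [[+ irr]|[z]].
  by rewrite covers_lower_footE // => /eqP->; exists y; rewrite ?inE.
by rewrite inE => irr [-> ->]; rewrite lower_foot_covers.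
Qed.

Lemma card_covers_red :
  #|[set e : T * T | covers le e.1 e.2 & red e.2]| = #|block_digraph le n| + n.-1.
Proof.
have lo_lt x : rk (lo x) < n by rewrite -num_red red_rank_lt.
pose lo_rank x := Ordinal (lo_lt x); pose ranks (e : T * T) := (lo_rank e.1, lo_rank e.2).
have card_sum (A : {set 'I_n * 'I_n}) : #|A| = \sum_p (p \in A).
  by rewrite -sum1_card big_mkcond; apply: eq_bigr => p _; case: (_ \in _).
rewrite -sum1_card (partition_big ranks predT) //= -(card_consecutive n) !card_sum -big_split /=.
apply: eq_bigr => -[i j] _; rewrite !inE sum1dep_card /consecutive.
have [|y red_y rk_y] := @red_rank_surj _ _ le_RC j; first by rewrite num_red.
rewrite /= -rk_y -(card_lower_covers_foot i red_y).
rewrite -[RHS](card_imset _ (_ : injective (fun x => (x, y)))); last by move=> ? ? [].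
apply: eq_card => -[x z]; rewrite !inE; apply/andP/imsetP => /= [[/andP[xz red_z]]|[x']].
  rewrite xpair_eqE -!val_eqE /= (lower_foot_id red_z) -rk_y => /andP[lo_x].
  by move/eqP/(red_rank_inj le_RC red_z red_y) => <-; exists x; rewrite // inE xz.
rewrite inE => /andP[xy lo_x] [-> ->].
by rewrite xpair_eqE -!val_eqE /= (lower_foot_id red_y) xy red_y lo_x rk_y eqxx.
Qed.

Lemma nullity_fundamental_block : nullity le setT = #|block_digraph le n|.
Proof.
have [m m_bottom] := bottom_exists (proj1 le_RC).
apply/eqP; rewrite -(eqn_add2r #|[set: T]|) (nullity_bottom (proj1 (proj1 le_RC)) (in_setT m)) //.
rewrite -(cardsID [set e | red e.2] (cover_pairs le setT)).
have -> : cover_pairs le setT :&: [set e | red e.2] = [set e | covers le e.1 e.2 & red e.2].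
  by apply/setP => e; rewrite !inE.
have -> : cover_pairs le setT :\: [set e | red e.2] = [set e | covers le e.1 e.2 & ~~ red e.2].
  by apply/setP => e; rewrite !inE andbC.
rewrite card_covers_red card_covers_irr cardsT -(cardsC [set x | red x]).
rewrite -/(num_reducible le) num_red.
have -> : ~: [set x | red x] = [set x | ~~ red x] by apply/setP => x; rewrite !inE.
by rewrite -addnA -addnS -addSn prednK // ltnW.
Qed.

End FundamentalBlock.

Lemma fiber_inj (T1 T2 : finType) (K : eqType) (f1 : T1 -> K) (f2 : T2 -> K) (y0 : T2) :
  (forall k, #|[set x | f1 x == k]| = #|[set y | f2 y == k]|) ->
  exists2 g : T1 -> T2, injective g & forall x, f2 (g x) = f1 x.
Proof.
move=> card_fibers.
pose fiber1 k := enum [set x | f1 x == k]; pose fiber2 k := enum [set y | f2 y == k].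
have size_fibers k : size (fiber1 k) = size (fiber2 k) by rewrite -!cardE.
have mem_fiber1 x : x \in fiber1 (f1 x) by rewrite mem_enum inE.
pose g x := nth y0 (fiber2 (f1 x)) (index x (fiber1 (f1 x))).
have index_lt x : index x (fiber1 (f1 x)) < size (fiber2 (f1 x)).
  by rewrite -size_fibers index_mem.
have f2_g x : f2 (g x) = f1 x.
  by have := mem_nth y0 (index_lt x); rewrite mem_enum inE => /eqP.
exists g => // x y eq_g; have eq_f : f1 x = f1 y by rewrite -!f2_g eq_g.
have /eqP := eq_g; rewrite /g eq_f nth_uniq ?enum_uniq // -?eq_f // => /eqP eq_index.
by rewrite -(nth_index x (mem_fiber1 x)) eq_index eq_f nth_index.
Qed.

Lemma fiber_bij (T1 T2 : finType) (K : eqType) (f1 : T1 -> K) (f2 : T2 -> K)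
    (x0 : T1) (y0 : T2) :
  (forall k, #|[set x | f1 x == k]| = #|[set y | f2 y == k]|) ->
  exists2 g : T1 -> T2, bijective g & forall x, f2 (g x) = f1 x.
Proof.
move=> card_fibers; have [g g_inj f2_g] := fiber_inj y0 card_fibers.
have [h h_inj _] := fiber_inj x0 (fun k => esym (card_fibers k)).
by exists g => //; apply: inj_card_bij => //; apply: leq_card h_inj.
Qed.

Section Isomorphism.
Variable n : nat.
Hypothesis n_gt1 : 1 < n.

Lemma foot_rank_transfer (T1 T2 : finType) (le1 : rel T1) (le2 : rel T2) x :
  fundamental_basic_block le1 -> fundamental_basic_block le2 ->
  num_reducible le1 = n -> num_reducible le2 = n ->
  (forall i j : 'I_n, GF_arc le1 i j -> GF_arc le2 i j) ->
  exists y, foot_rank le2 y = foot_rank le1 x.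
Proof.
move=> fund1 fund2 num1 num2 arcs; have [red_x|irr] := boolP (reducible le1 x).
  have [|y red_y rk_y] := @red_rank_surj _ _ (proj1 fund2) (red_rank le1 x).
    by rewrite num2 -num1 red_rank_lt.
  by exists y; rewrite !foot_rank_id // rk_y.
have [lt_lo lt_hi] := foot_rank_lt (fundamental_RC_block fund1 num1 n_gt1) x.
rewrite num1 in lt_lo lt_hi.
have : GF_arc le1 (Ordinal lt_lo) (Ordinal lt_hi).
  by apply/(GF_arcP fund1 num1 n_gt1)/exists_inP; exists x.
by move/arcs/(GF_arcP fund2 num2 n_gt1)/exists_inP => [y _ /eqP foot_y]; exists y.
Qed.

Lemma fundamental_block_iso (T1 T2 : finType) (le1 : rel T1) (le2 : rel T2) :
  fundamental_basic_block le1 -> fundamental_basic_block le2 ->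
  num_reducible le1 = n -> num_reducible le2 = n ->
  (forall i j : 'I_n, GF_arc le1 i j <-> GF_arc le2 i j) -> poset_iso le1 le2.
Proof.
move=> fund1 fund2 num1 num2 arcs.
have block1 := fundamental_RC_block fund1 num1 n_gt1.
have block2 := fundamental_RC_block fund2 num2 n_gt1.
have /card_gt0P[x0 _] := proj1 (proj2 (proj1 (proj1 block1))).
have /card_gt0P[y0 _] := proj1 (proj2 (proj1 (proj1 block2))).
have transfer12 x := foot_rank_transfer x fund1 fund2 num1 num2 (fun i j => proj1 (arcs i j)).
have transfer21 y := foot_rank_transfer y fund2 fund1 num2 num1 (fun i j => proj2 (arcs i j)).
have [k|g g_bij foot_g] := @fiber_bij _ _ _ (foot_rank le1) (foot_rank le2) x0 y0.
  have [x /eqP<-|no_x] := pickP [pred x | foot_rank le1 x == k].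
    have [y foot_y] := transfer12 x.
    by rewrite (card_foot_rank_fiber fund1 num1) // -foot_y (card_foot_rank_fiber fund2 num2).
  rewrite !eq_card0 // => [y|x]; rewrite inE; last exact: no_x.
  by apply/eqP => foot_y; have [x] := transfer21 y; rewrite foot_y => /eqP; rewrite [_ == _]no_x.
exists g; split=> // x y.
by rewrite (le_foot_order block1) (le_foot_order block2) /foot_order !foot_g (bij_eq g_bij).
Qed.

End Isomorphism.

(** * Invariance under isomorphism *)

Lemma is_lub_in_iso (T1 T2 : finType) (le1 : rel T1) (le2 : rel T2) (f : T1 -> T2)
    (g : T2 -> T1) (S : {pred T1}) x y j :
  cancel f g -> cancel g f -> (forall x y, le1 x y = le2 (f x) (f y)) ->
  is_lub_in le2 [pred u | g u \in S] (f x) (f y) (f j) = is_lub_in le1 S x y j.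
Proof.
move=> fK gK f_mono; rewrite /is_lub_in !inE fK -!f_mono; do 3!congr andb.
apply/forallP/forallP => least z.
  by have := least (f z); rewrite !inE fK -!f_mono.
by have := least (g z); rewrite !inE !f_mono gK.
Qed.

Section Transport.
Variables (T1 T2 : finType) (le1 : rel T1) (le2 : rel T2) (f : T1 -> T2) (g : T2 -> T1).
Hypotheses (fK : cancel f g) (gK : cancel g f).
Hypothesis f_mono : forall x y, le1 x y = le2 (f x) (f y).

Let is_glb_in_iso (S : {pred T1}) x y m :
  is_glb_in le2 [pred u | g u \in S] (f x) (f y) (f m) = is_glb_in le1 S x y m.
Proof.
exact: (is_lub_in_iso (le1 := converse le1) (le2 := converse le2) _ _ _ _ fK gK
  (fun x y => f_mono y x)).
Qed.

Lemma lattice_on_iso (S : {pred T1}) :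
  is_lattice_on le1 S -> is_lattice_on le2 [pred u | g u \in S].
Proof.
move=> lattice u v uS vS; have [[j lub_j] [m glb_m]] := lattice (g u) (g v) uS vS.
split; [exists (f j)|exists (f m)]; rewrite -[u]gK -[v]gK.
  by rewrite (is_lub_in_iso _ _ _ _ fK gK f_mono).
by rewrite is_glb_in_iso.
Qed.

Lemma reducible_iso x : reducible le2 (f x) = reducible le1 x.
Proof.
have bound_iso y z : is_lub le2 (f y) (f z) (f x) || is_glb le2 (f y) (f z) (f x)
    = is_lub le1 y z x || is_glb le1 y z x.
  by rewrite /is_lub /is_glb -(is_lub_in_iso _ _ _ _ fK gK f_mono) -is_glb_in_iso.
apply/reducibleP/reducibleP => -[y [z]]; last first.
  by exists (f y), (f z); rewrite !(can_eq fK) bound_iso.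
by exists (g y), (g z); rewrite -!(can_eq fK) -bound_iso !gK.
Qed.

Lemma red_rank_iso x : red_rank le2 (f x) = red_rank le1 x.
Proof.
rewrite /red_rank -(card_imset _ (can_inj fK)); apply: eq_card => u; rewrite !inE.
apply/idP/imsetP => [red_u|[y]].
  by exists (g u); rewrite ?gK // inE -reducible_iso f_mono -(can_eq fK) !gK.
by rewrite inE f_mono -reducible_iso -(can_eq fK) => red_y ->.
Qed.

Lemma adj_rep_iso r c a b :
  adj_rep le1 r c a b -> adj_rep le2 r (c \o g) (f \o a) (f \o b).
Proof.
have g_mono u v : le2 u v = le1 (g u) (g v) by rewrite f_mono !gK.
case=> c_le [[root c_root] [chain0 [max0 step]]]; split; first by move=> u; apply: c_le.
split; first by exists (f root); rewrite /= fK.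
split; first by move=> u v cu cv; rewrite !g_mono chain0.
split=> [u u_comp|i /step].
  by apply: max0 => x cx; rewrite -[x]fK -!g_mono; apply: u_comp; rewrite /= fK.
case=> [[w cw] [chain [lattice [ca [cb [ab [neq_ab [between_ab [below above]]]]]]]]].
have [z [cz [neq_za [neq_zb [az zb]]]]] := between_ab.
split; first by exists (f w); rewrite /= fK.
split; first by move=> u v cu cv; rewrite !g_mono chain.
split; first exact: lattice_on_iso lattice.
rewrite /= !fK -f_mono; split=> //; split=> //; split=> //.
split; first by move/(can_inj fK).
split; first by exists (f z); rewrite fK -!f_mono; split=> //; split; [|split] => // /(can_inj fK).
by split=> u v cu cv; rewrite !g_mono fK; [apply: below|apply: above].
Qed.

Lemma GF_arc_iso n (i j : 'I_n) : GF_arc le1 i j -> GF_arc le2 i j.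
Proof.
case=> x [y [ranks [r [c [a [b [rep [k [k_range [ak bk]]]]]]]]]].
exists (f x), (f y); rewrite !reducible_iso !red_rank_iso; split=> //.
exists r, (c \o g), (f \o a), (f \o b); split; first exact: adj_rep_iso.
by exists k; rewrite /= ak bk.
Qed.

End Transport.

Lemma GF_arc_invariant (T1 T2 : finType) (le1 : rel T1) (le2 : rel T2) n (i j : 'I_n) :
  poset_iso le1 le2 -> GF_arc le1 i j <-> GF_arc le2 i j.
Proof.
case=> f [[g fK gK] f_mono]; split; first exact: GF_arc_iso fK gK f_mono _ i j.
by apply: (GF_arc_iso gK fK) => u v; rewrite f_mono !gK.
Qed.

(** * The block of a digraph *)

Section DigraphBlock.
Variables (n : nat) (D : {set 'I_n * 'I_n}).

(* The vertices, a second irreducible element for every arc between consecutive vertices (a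
   single one would be the only path between them), and one irreducible element per arc. The
   first two summands form the maximal chain of the adjunct representation. *)
Notation spine := ('I_n + {p | (p \in D) && consecutive p})%type.
Notation digraph_block := (spine + {p | p \in D})%type.

Definition ends (x : digraph_block) : 'I_n * 'I_n :=
  match x with
  | inl (inl k) => (k, k)
  | inl (inr q) => val q
  | inr p => val p
  end.

Definition digraph_le : rel digraph_block :=
  foot_order (fun x => ((ends x).1 : nat, (ends x).2 : nat)).

Definition vert (k : 'I_n) : digraph_block := inl (inl k).

Lemma vert_inj : injective vert.
Proof. by move=> i j []. Qed.

Definition irr_ends (x : digraph_block) : bool := (ends x).1 < (ends x).2.

Hypothesis n_gt1 : 1 < n.
Hypothesis D_lt : forall p, p \in D -> p.1 < p.2.
Hypothesis D_cover : forall v, exists2 p, p \in D & (p.1 == v) || (p.2 == v).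

Lemma irr_ends_arc (p : {p | p \in D}) : irr_ends (inr p).
Proof. exact: D_lt (valP p). Qed.

Lemma irr_ends_twin (q : {p | (p \in D) && consecutive p}) : irr_ends (inl (inr q)).
Proof. by have /andP[qD _] := valP q; apply: D_lt. Qed.

Lemma ends_le x : (ends x).1 <= (ends x).2.
Proof.
by case: x => [[k|q]|p] //=; [apply: ltnW (irr_ends_twin q)|apply: ltnW (irr_ends_arc p)].
Qed.

Lemma not_irr_ends x : ~~ irr_ends x -> x = vert (ends x).1.
Proof. by case: x => [[k|q]|p] //; rewrite ?irr_ends_twin ?irr_ends_arc. Qed.

Lemma digraph_le_refl : reflexive digraph_le.
Proof. by move=> x; rewrite /digraph_le /foot_order eqxx. Qed.

Lemma digraph_le_neq x y : x != y -> digraph_le x y = ((ends x).2 <= (ends y).1).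
Proof. by rewrite /digraph_le /foot_order => /negPf->. Qed.

Lemma digraph_le_vert x k : digraph_le x (vert k) = ((ends x).2 <= k).
Proof.
by have [->|/digraph_le_neq//] := eqVneq x (vert k); rewrite digraph_le_refl leqnn.
Qed.

Lemma vert_digraph_le x k : digraph_le (vert k) x = (k <= (ends x).1).
Proof.
by have [<-|/digraph_le_neq//] := eqVneq (vert k) x; rewrite digraph_le_refl leqnn.
Qed.

Lemma eq_vert x (k : 'I_n) : (ends x).2 <= k -> k <= (ends x).1 -> x = vert k.
Proof.
move=> hi_k k_lo; have /not_irr_ends-> : ~~ irr_ends x by rewrite -leqNgt (leq_trans hi_k).
by congr vert; apply/val_inj/eqP; rewrite eqn_leq k_lo (leq_trans (ends_le x)).
Qed.

Lemma digraph_poset : is_poset digraph_le.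
Proof.
split; [|split] => [|x y|y x z]; first exact: digraph_le_refl.
- have [//|neq_xy] := eqVneq x y; rewrite digraph_le_neq // digraph_le_neq 1?eq_sym //.
  case/andP=> xy yx; rewrite (@eq_vert x (ends y).1) //; last exact: leq_trans (ends_le y) yx.
  by rewrite [RHS](@eq_vert y (ends y).1) // (leq_trans yx) // (leq_trans (ends_le x)).
rewrite /digraph_le /foot_order => /orP[/eqP->//|xy] /orP[/eqP<-|yz]; first by rewrite xy orbT.
by rewrite (leq_trans xy (leq_trans (ends_le y) yz)) orbT.
Qed.

Lemma digraph_lattice_on (S : {pred digraph_block}) :
  (forall k, vert k \in S) -> is_lattice_on digraph_le S.
Proof.
move=> vert_S x y xS yS; have [comparable|] := boolP (digraph_le x y || digraph_le y x).
  by split; [apply: comparable_lub_in|apply: comparable_glb_in] => //; apply: digraph_poset.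
rewrite negb_or => /andP[not_xy not_yx].
have neq_xz z : digraph_le y z -> x != z by apply: contraTneq => <-.
have neq_yz z : digraph_le x z -> y != z by apply: contraTneq => <-.
have neq_zx z : digraph_le z y -> z != x by apply: contraTneq => ->.
have neq_zy z : digraph_le z x -> z != y by apply: contraTneq => ->.
pose top := if (ends x).2 <= (ends y).2 then (ends y).2 else (ends x).2.
pose bottom := if (ends x).1 <= (ends y).1 then (ends x).1 else (ends y).1.
split; [exists (vert top); apply/is_lub_inP|exists (vert bottom); apply/is_glb_inP].
  rewrite vert_S !digraph_le_vert /top; split=> // [||z _ xz yz].
  - by case: (leqP (ends x).2 (ends y).2).
  - by case: (leqP (ends x).2 (ends y).2) => // /ltnW.
  by rewrite vert_digraph_le; case: ifP => _; rewrite -digraph_le_neq // ?neq_yz ?neq_xz.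
rewrite vert_S !vert_digraph_le /bottom; split=> // [||z _ zx zy].
- by case: (leqP (ends x).1 (ends y).1) => // /ltnW.
- by case: (leqP (ends x).1 (ends y).1).
by rewrite digraph_le_vert; case: ifP => _; rewrite -digraph_le_neq // ?neq_zy ?neq_zx.
Qed.

Lemma digraph_lattice : is_finite_lattice digraph_le.
Proof.
split; first exact: digraph_poset; split; last exact: digraph_lattice_on.
by apply/card_gt0P; exists (vert (Ordinal (ltnW n_gt1))).
Qed.

Lemma between_ends x : irr_ends x ->
  between digraph_le (vert (ends x).1) (vert (ends x).2) x.
Proof.
move=> irr; rewrite /between vert_digraph_le digraph_le_vert !leqnn /=.
by apply/andP; split; apply: contraTneq irr => ->; rewrite /irr_ends ltnn.
Qed.

Lemma lower_covers_ends x z : irr_ends x ->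
  covers digraph_le z x = (z == vert (ends x).1).
Proof.
move=> irr; have /and4P[lo_x _ neq_xlo _] := between_ends irr.
apply/idP/eqP => [zx|->].
  have [le_zx neq_zx _] := coversP _ _ _ zx.
  have z_lo : digraph_le z (vert (ends x).1) by rewrite digraph_le_vert -digraph_le_neq.
  by have [->//|ex] := covers_between zx z_lo lo_x; rewrite ex eqxx in neq_xlo.
apply/coversP; split=> [//||w]; first by rewrite eq_sym.
apply/negP => /and4P[lo_w wx neq_wlo neq_wx]; case/eqP: neq_wlo.
by apply: eq_vert; rewrite -?digraph_le_neq // -vert_digraph_le.
Qed.

Lemma upper_covers_ends x z : irr_ends x ->
  covers digraph_le x z = (z == vert (ends x).2).
Proof.
move=> irr; have /and4P[_ x_hi _ neq_xhi] := between_ends irr.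
apply/idP/eqP => [xz|->].
  have [le_xz neq_xz _] := coversP _ _ _ xz.
  have hi_z : digraph_le (vert (ends x).2) z by rewrite vert_digraph_le -digraph_le_neq.
  by have [ex|->//] := covers_between xz x_hi hi_z; rewrite ex eqxx in neq_xhi.
apply/coversP; split=> [//|//|w].
apply/negP => /and4P[xw w_hi neq_wx neq_whi]; case/eqP: neq_whi.
by apply: eq_vert; rewrite -?digraph_le_neq 1?eq_sym // -digraph_le_vert.
Qed.

Lemma doubly_irr_ends x : irr_ends x -> doubly_irr digraph_le x.
Proof.
move=> irr; apply/andP; split; apply/card_le1_eqP => u v; rewrite !inE.
  by rewrite !upper_covers_ends // => /eqP-> /eqP->.
by rewrite !lower_covers_ends // => /eqP-> /eqP->.
Qed.

Lemma arc_spine_detour (p : {p | p \in D}) :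
  exists s : spine, between digraph_le (vert (val p).1) (vert (val p).2) (inl s).
Proof.
have lt_p : (val p).1 < (val p).2 := D_lt (valP p).
have [consec|not_consec] := boolP (consecutive (val p)).
  have twinP : (val p \in D) && consecutive (val p) by rewrite (valP p).
  by exists (inr (exist _ (val p) twinP)); apply: between_ends (irr_ends_twin _).
have lt_Sp : (val p).1.+1 < (val p).2 by rewrite ltn_neqAle eq_sym not_consec.
pose k := Ordinal (ltn_trans lt_Sp (ltn_ord _)); exists (inl k); rewrite -/(vert k) /between.
rewrite vert_digraph_le digraph_le_vert /= leqnSn (ltnW lt_Sp) !(inj_eq vert_inj) -!val_eqE /=.
by rewrite gtn_eqF // ltn_eqF.
Qed.

Lemma bypassed_ends x : irr_ends x -> bypassed digraph_le x.
Proof.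
move=> irr; exists (vert (ends x).1), (vert (ends x).2).
rewrite lower_covers_ends // upper_covers_ends // !eqxx.
case: x irr => [[k|q]|p] irr; first by rewrite /irr_ends ltnn in irr.
  have qD : val q \in D by case/andP: (valP q).
  by exists (inr (exist _ (val q) qD)); split=> //; apply: between_ends (irr_ends_arc _).
by have [s between_s] := arc_spine_detour p; exists (inl s).
Qed.

Lemma vert_reducible k : reducible digraph_le (vert k).
Proof.
have [p pD] := D_cover k; pose x : digraph_block := inr (exist _ p pD).
have irr : irr_ends x := irr_ends_arc _.
case/orP=> /eqP<-.
  apply: (bypassed_lower_reducible digraph_poset (doubly_irr_ends irr) (bypassed_ends irr)).
  by rewrite lower_covers_ends.
rewrite -reducible_converse; apply: (bypassed_lower_reducible (x := x)).
- exact: poset_converse digraph_poset.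
- by rewrite doubly_irr_converse doubly_irr_ends.
- exact: bypassed_converse (bypassed_ends irr).
by rewrite covers_converse upper_covers_ends.
Qed.

Lemma digraph_reducible x : reducible digraph_le x = ~~ irr_ends x.
Proof.
have [irr|/not_irr_ends->] := boolP (irr_ends x); last by rewrite vert_reducible.
by rewrite (reducibleE _ digraph_lattice) doubly_irr_ends.
Qed.

Lemma digraph_RC_lattice : is_RC_lattice digraph_le.
Proof.
split=> [|x y]; first exact: digraph_lattice.
rewrite !digraph_reducible => /not_irr_ends-> /not_irr_ends->.
by rewrite !digraph_le_vert leq_total.
Qed.

Lemma digraph_RC_block : RC_block digraph_le.
Proof.
split; first exact: digraph_RC_lattice.
by move=> x; rewrite digraph_reducible negbK; apply: bypassed_ends.
Qed.

Lemma digraph_num_reducible : num_reducible digraph_le = n.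
Proof.
rewrite /num_reducible -[RHS]card_ord -[RHS](card_imset _ vert_inj); apply: eq_card => x.
rewrite inE digraph_reducible; apply/idP/imsetP => [/not_irr_ends->|[k _ ->]].
  by exists (ends x).1.
by rewrite /irr_ends ltnn.
Qed.

Lemma red_rank_vert k : red_rank digraph_le (vert k) = k.
Proof.
have -> : red_rank digraph_le (vert k) = #|[set j : 'I_n | j < k]|.
  rewrite -(card_imset _ vert_inj); apply: eq_card => x.
  rewrite !inE digraph_reducible digraph_le_vert; apply/and3P/imsetP.
    case=> /not_irr_ends-> /= le_k neq_k; exists (ends x).1 => //.
    by rewrite inE ltn_neqAle le_k andbT; apply: contra neq_k => /eqP/val_inj->.
  case=> j; rewrite inE => lt_jk ->; rewrite /irr_ends ltnn ltnW // (inj_eq vert_inj).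
  by rewrite -val_eqE /= ltn_eqF.
rewrite -sum1_card (eq_bigl (fun j : 'I_n => j < k)) => [|j]; last by rewrite inE.
by rewrite -(big_ord_widen n (fun=> 1) (ltnW (ltn_ord k))) sum_nat_const card_ord muln1.
Qed.

Lemma feet_ends x : feet digraph_le x = (vert (ends x).1, vert (ends x).2).
Proof.
rewrite /feet; have [irr|not_irr] := boolP (irr_ends x); last first.
  rewrite (not_irr_ends not_irr) lower_foot_id ?upper_foot_id ?vert_reducible //.
have irr_x : ~~ reducible digraph_le x by rewrite digraph_reducible negbK.
have := lower_foot_covers digraph_RC_block irr_x; have := upper_foot_covers digraph_RC_block irr_x.
by rewrite (lower_covers_ends _ irr) (upper_covers_ends _ irr) => /eqP-> /eqP->.
Qed.

Lemma digraph_block_digraph : block_digraph digraph_le n = D.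
Proof.
have foot_rankE x : foot_rank digraph_le x = ((ends x).1 : nat, (ends x).2 : nat).
  by have [lo_x hi_x] := feet_ends x; rewrite /foot_rank lo_x hi_x !red_rank_vert.
apply/setP => -[i j]; rewrite inE; apply/exists_inP/idP => /= [[x]|ijD].
  rewrite digraph_reducible negbK foot_rankE => irr /eqP[/val_inj<- /val_inj<-].
  rewrite -surjective_pairing; case: x irr => [[k|q]|p] /=; last by move=> _; apply: valP.
    by rewrite /irr_ends ltnn.
  by move=> _; case/andP: (valP q).
exists (inr (exist _ (i, j) ijD)); last by rewrite foot_rankE.
by rewrite digraph_reducible irr_ends_arc.
Qed.

Definition chain_index (x : digraph_block) : nat :=
  if x is inr p then (index (val p) (enum D)).+1 else 0.

Definition nth_arc (i : nat) : 'I_n * 'I_n :=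
  let k0 := Ordinal (ltnW n_gt1) in nth (k0, k0) (enum D) i.-1.

Lemma chain_singleton i : 0 < i <= #|D| ->
  exists2 p : {p | p \in D}, val p = nth_arc i & forall x, (chain_index x == i) = (x == inr p).
Proof.
case: i => // i; rewrite cardE ltnS => lt_iD.
have pD : nth_arc i.+1 \in D by rewrite -mem_enum mem_nth.
exists (exist _ (nth_arc i.+1) pD) => // -[s|q] //; apply/eqP/eqP => [[idx_q]|[->]].
  by congr inr; apply: val_inj; rewrite /= /nth_arc /= -idx_q nth_index // mem_enum (valP q).
by rewrite /= index_uniq ?enum_uniq.
Qed.

Lemma spine_comparable (s t : spine) :
  digraph_le (inl s) (inl t) || digraph_le (inl t) (inl s).
Proof.
have consec (q : {p | (p \in D) && consecutive p}) : (val q).2 = (val q).1.+1 :> nat.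
  by case/andP: (valP q) => _ /eqP.
case: s t => [i|q] [j|q'].
- by rewrite -/(vert i) -/(vert j) !digraph_le_vert leq_total.
- by rewrite -/(vert i) vert_digraph_le digraph_le_vert /= consec; case: leqP.
- by rewrite -/(vert j) vert_digraph_le digraph_le_vert /= consec; case: ltnP.
have [->|neq_q] := eqVneq q q'; first by rewrite digraph_le_refl.
have neq_twin : inl (inr q) != inl (inr q') :> digraph_block by apply: contra_neq neq_q => -[].
rewrite (digraph_le_neq neq_twin) digraph_le_neq 1?eq_sym // /ends !consec -neq_ltn.
apply: contra neq_q => /eqP eq_lo; apply/eqP/val_inj.
rewrite [LHS]surjective_pairing [RHS]surjective_pairing; congr pair; apply: val_inj => //=.
by rewrite !consec eq_lo.
Qed.

Lemma spine_detour_incomparable (p : {p | p \in D}) (s : spine) :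
  between digraph_le (vert (val p).1) (vert (val p).2) (inl s) ->
  ~~ digraph_le (inr p) (inl s) && ~~ digraph_le (inl s) (inr p).
Proof.
have irr : ~~ reducible digraph_le (inr p) by rewrite digraph_reducible negbK irr_ends_arc.
have [lo_p hi_p] := feet_ends (inr p); rewrite -[vert _]lo_p -[vert (val p).2]hi_p => detour.
exact: (between_feet_incomparable digraph_RC_block irr detour).
Qed.

Lemma digraph_adj_rep :
  adj_rep digraph_le #|D| chain_index (vert \o fst \o nth_arc) (vert \o snd \o nth_arc).
Proof.
split; first by case=> // p; rewrite /= cardE index_mem mem_enum (valP p).
split; first by exists (vert (Ordinal (ltnW n_gt1))).
split; first by case=> [s|p] [t|q] // _ _; apply: spine_comparable.
split.
  case=> // p; have [s detour] := arc_spine_detour p => /(_ (inl s) erefl).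
  by have /andP[/negPf-> /negPf->] := spine_detour_incomparable detour.
move=> i i_range; have [p /= <- chain_p] := chain_singleton i_range.
have lt_p : (val p).1 < (val p).2 := D_lt (valP p).
have in_chain x : chain_index x = i -> x = inr p by move/eqP; rewrite chain_p => /eqP.
have i_gt0 : 0 < i by case/andP: i_range.
split; first by exists (inr p); apply/eqP; rewrite chain_p.
split; first by move=> x y /in_chain-> /in_chain->; rewrite digraph_le_refl.
split; first exact: digraph_lattice_on.
split=> //; split=> //; split; first by rewrite digraph_le_vert ltnW.
split; first by move/vert_inj => eq_p; rewrite eq_p ltnn in lt_p.
split.
  have [s /and4P[lo_s s_hi /eqP neq_lo /eqP neq_hi]] := arc_spine_detour p.
  by exists (inl s).
have neq_p x : chain_index x < i -> x != inr p by rewrite -chain_p => /ltn_eqF->.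
split=> x y => [cx /in_chain->|/in_chain-> cy].
  by rewrite digraph_le_vert digraph_le_neq // neq_p.
by rewrite vert_digraph_le digraph_le_neq // eq_sym neq_p.
Qed.

Lemma digraph_fundamental : fundamental_basic_block digraph_le.
Proof.
split; first exact: digraph_RC_lattice; split.
  apply/RC_blockP; [exact: digraph_RC_lattice| |exact: digraph_RC_block].
  by apply: leq_trans n_gt1 _; rewrite -[X in X <= _]digraph_num_reducible max_card.
exists #|D|, chain_index, (vert \o fst \o nth_arc), (vert \o snd \o nth_arc).
split=> [|i j i_range j_range /vert_inj eq_lo /vert_inj eq_hi]; first exact: digraph_adj_rep.
have [p val_p chain_p] := chain_singleton i_range.
have [q val_q chain_q] := chain_singleton j_range.
have eq_pq : p = q.
  apply: val_inj; rewrite val_p val_q [LHS]surjective_pairing [RHS]surjective_pairing.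
  by rewrite eq_lo eq_hi.
have /eqP<- : chain_index (inr p) == i by rewrite chain_p.
by apply/eqP; rewrite chain_q eq_pq.
Qed.

End DigraphBlock.

Lemma DgraphP n l (D : {set 'I_n * 'I_n}) : Dgraph l D ->
  [/\ forall p, p \in D -> p.1 < p.2, #|D| = l &
      forall v, exists2 p, p \in D & (p.1 == v) || (p.2 == v)].
Proof.
by case/and3P=> /forall_inP lt /eqP card /forallP cover; split=> // v; apply/exists_inP.
Qed.

Theorem mainTheorem14 (n l : nat) :
  2 <= n -> (n.+1)./2 <= l <= 'C(n, 2) ->
  (* the map is well defined on isomorphism classes *)
  (forall (T1 T2 : finType) (le1 : rel T1) (le2 : rel T2),
     in_Fnl n l le1 -> in_Fnl n l le2 -> poset_iso le1 le2 ->
     forall i j : 'I_n, GF_arc le1 i j <-> GF_arc le2 i j) /\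
  (* it lands in D(n,l) *)
  (forall (T : finType) (le : rel T), in_Fnl n l le ->
     exists D : {set 'I_n * 'I_n}, Dgraph l D /\
       forall i j : 'I_n, (i, j) \in D <-> GF_arc le i j) /\
  (* injective on isomorphism classes *)
  (forall (T1 T2 : finType) (le1 : rel T1) (le2 : rel T2),
     in_Fnl n l le1 -> in_Fnl n l le2 ->
     (forall i j : 'I_n, GF_arc le1 i j <-> GF_arc le2 i j) ->
     poset_iso le1 le2) /\
  (* surjective onto D(n,l) *)
  (forall D : {set 'I_n * 'I_n}, Dgraph l D ->
     exists (T : finType) (le : rel T), in_Fnl n l le /\
       forall i j : 'I_n, (i, j) \in D <-> GF_arc le i j).
Proof.
move=> n_gt1 _; split; [|split; [|split]].
- by move=> T1 T2 le1 le2 _ _ iso i j; apply: GF_arc_invariant.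
- move=> T le [fund [num_red <-]]; exists (block_digraph le n).
  rewrite (nullity_fundamental_block fund num_red n_gt1).
  split; first exact: Dgraph_block_digraph fund num_red n_gt1.
  exact: mem_block_digraph fund num_red n_gt1.
- move=> T1 T2 le1 le2 [fund1 [num_red1 _]] [fund2 [num_red2 _]].
  exact: fundamental_block_iso.
move=> D /DgraphP[D_lt card_D D_cover].
have fund := digraph_fundamental n_gt1 D_lt D_cover.
have num_red := digraph_num_reducible n_gt1 D_lt D_cover.
have digraphE := digraph_block_digraph n_gt1 D_lt D_cover.
exists _, (digraph_le (D := D)); split; last first.
  by move=> i j; have := mem_block_digraph fund num_red n_gt1 i j; rewrite digraphE.
by split=> //; rewrite (nullity_fundamental_block fund num_red n_gt1) digraphE.
Qed.
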